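(* Let $k\geq 2$ be an integer, let $G$ be a weighted graph on $n$ vertices, and let $H_0$ be the spanner of $G$ produced by the Baswana–Sen algorithm with parameter $k$. During the $(k,k-1)$-completion of $H_0$, at most $\tilde{O}(n^{1+1/k})$ edges are added.
   Context: $G=(V,E,w)$ is an undirected graph with positive edge weights, in which every edge is a shortest path between its endpoints; $\mathrm{dist}_X$ is the weighted shortest-path distance in a graph $X$ and $W_{\max}(G)$ the maximum edge weight. The Baswana–Sen algorithm (Baswana and Sen, 2007) is the randomized clustering algorithm that computes a $(2k-1)$-spanner with $\tilde{O}(n^{1+1/k})$ edges using a sampled hierarchy of center sets $V=S_0\supseteq S_1\supseteq\cdots$, each obtained from the previous by sampling with probability $\tilde{O}(n^{-1/k})$. For a shortest path $P_{x,y}=(x_0,\ldots,x_t)$ in $G$ and $H\subseteq G$, an $\alpha$-segmentation is a sequence of index intervals $([i_0,i_1],\ldots,[i_{s-1},i_s])$ with $0=i_0<\cdots<i_s=t$ such that every segment with $i_j-i_{j-1}\geq2$ satisfies $\mathrm{dist}_H(x_{i_{j-1}},x_{i_j})\leq\alpha\,\mathrm{dist}_G(x_{i_{j-1}},x_{i_j})$; it is minimal if no consecutive sequence of segments can be merged to give another $\alpha$-segmentation. $E_\alpha(\mathcal{S},H)$ is the set of edges $e=\{u,v\}$ forming length-one segments of $\mathcal{S}$ with $\mathrm{dist}_H(u,v)>\alpha w(e)$. The $(\alpha,\beta)$-completion of $H_0$: set $H\gets H_0$; while some pair $x,y$ has $\mathrm{dist}_H(x,y)>\alpha\,\mathrm{dist}_G(x,y)+\beta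 W_{\max}(G)$, pick such a pair, a shortest $x$–$y$ path $P_{x,y}$ in $G$, a minimal $\alpha$-segmentation $\mathcal{S}$ of it w.r.t. the current $H$, and set $H\gets H\cup E_\alpha(\mathcal{S},H)$. Here $\alpha=k$, $\beta=k-1$. $\tilde{O}$ hides polylogarithmic factors in $n$. *)

(* Defs.v *)
From HB Require Import structures.
From mathcomp Require Import all_boot all_order all_algebra.
From mathcomp Require Import all_classical all_reals all_analysis.

Set Implicit Arguments.
Unset Strict Implicit.
Unset Printing Implicit Defensive.

Import Order.TTheory GRing.Theory Num.Theory.
Local Open Scope ring_scope.

(* Conventions.
   Vertices: 'I_n.  An edge is a 2-element set [set u; v] of vertices.
   A weighted graph G = (E, w): E : {set {set 'I_n}} (all of cardinality 2),
   w : {set 'I_n} -> R (only its values on E matter).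
   Subgraphs H of G are edge sets H \subset E (same vertex set). *)

Section Graph.
Variables (R : realType) (n : nat) (w : {set 'I_n} -> R).

Definition walk (F : {set {set 'I_n}}) (x y : 'I_n) (p : seq 'I_n) : bool :=
  path (fun u v => [set u; v] \in F) x p && (last x p == y).

Definition plen (x : 'I_n) (p : seq 'I_n) : R :=
  \sum_(e <- pairmap (fun u v => [set u; v]) x p) w e.

(* weighted shortest-path distance in the graph (V, F, w); +oo if no walk *)
Definition dist (F : {set {set 'I_n}}) (x y : 'I_n) : \bar R :=
  ereal_inf [set (plen x p)%:E | p in [set p | walk F x y p]].

Definition Wmax (E : {set {set 'I_n}}) : R := \big[Num.max/0]_(e in E) w e.

Definition shortest (E : {set {set 'I_n}}) (x y : 'I_n) (p : seq 'I_n) : Prop :=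
  walk E x y p /\ (plen x p)%:E = dist E x y.

Section Completion.
Variables (E : {set {set 'I_n}}) (alpha beta : nat).

Definition viol (H : {set {set 'I_n}}) (x y : 'I_n) : bool :=
  ((alpha%:R)%:E * dist E x y + (beta%:R)%:E * (Wmax E)%:E < dist H x y)%E.

Definition pv (x : 'I_n) (p : seq 'I_n) (i : nat) : 'I_n := nth x (x :: p) i.

Definition is_aseg (H : {set {set 'I_n}}) (x : 'I_n) (p : seq 'I_n)
    (I : seq nat) : bool :=
  [&& head 1%N I == 0%N, last 0%N I == size p, sorted ltn I &
      all (fun ab : nat * nat =>
             (ab.1.+2 <= ab.2)%N ==>
             (dist H (pv x p ab.1) (pv x p ab.2)
                <= (alpha%:R)%:E * dist E (pv x p ab.1) (pv x p ab.2))%E)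
          (zip I (behead I))].

(* minimal: merging any >= 2 consecutive segments (breakpoints a < b with
   b >= a + 2) does not give an alpha-segmentation *)
Definition minimal_aseg (H : {set {set 'I_n}}) (x : 'I_n) (p : seq 'I_n)
    (I : seq nat) : Prop :=
  is_aseg H x p I /\
  forall a b : nat, (a.+2 <= b)%N -> (b < size I)%N ->
    ~~ is_aseg H x p (take a.+1 I ++ drop b I).

Definition Ealpha (H : {set {set 'I_n}}) (x : 'I_n) (p : seq 'I_n)
    (I : seq nat) : {set {set 'I_n}} :=
  [set e | has (fun ab : nat * nat =>
                  [&& ab.2 == ab.1.+1,
                      e == [set pv x p ab.1; pv x p ab.2] &
                      ((alpha%:R)%:E * (w e)%:E
                         < dist H (pv x p ab.1) (pv x p ab.2))%E])
               (zip I (behead I))].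

Definition cstep (H H' : {set {set 'I_n}}) : Prop :=
  exists x y, viol H x y /\
  exists p I, shortest E x y p /\ minimal_aseg H x p I /\
              H' = H :|: Ealpha H x p I.

Inductive completes : {set {set 'I_n}} -> {set {set 'I_n}} -> Prop :=
  | completes_done H : (forall x y, ~~ viol H x y) -> completes H H
  | completes_step H H' Hf : cstep H H' -> completes H' Hf -> completes H Hf.

End Completion.
End Graph.

(* Given the sampled hierarchy, encoded by lvl : {ffun 'I_n -> 'I_k}
   (v \in S_i iff i <= lvl v, for 0 <= i <= k-1, and S_k = set0), the
   algorithm is deterministic once ties between edge weights are broken by
   the injective rank tb (edges are compared lexicographically by
   (w e, tb e)). Iterations i = 1 .. k-1 are the clustering phase; iteration
   i = k (where no cluster is sampled since S_k = set0) is exactly phase 2. *)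
Section BaswanaSen.
Variables (R : realType) (n k : nat) (E : {set {set 'I_n}})
  (w : {set 'I_n} -> R) (tb : {set 'I_n} -> nat) (lvl : {ffun 'I_n -> 'I_k}).

Definition elt (f e : {set 'I_n}) : bool :=
  (w f < w e) || ((w f == w e) && (tb f < tb e)%N).

Definition least (A : {set {set 'I_n}}) : option {set 'I_n} :=
  [pick e in A | [forall f in A, ~~ elt f e]].

Definition oset (o : option {set 'I_n}) : {set {set 'I_n}} :=
  if o is Some e then [set e] else finset.set0.

Record bs_state := BSState {
  clu : {ffun 'I_n -> option 'I_n};  (* center of the cluster of v, if any *)
  rest : {set {set 'I_n}};
  span : {set {set 'I_n}} }.

Definition Eadj (s : bs_state) (v c : 'I_n) : {set {set 'I_n}} :=
  [set e in rest s | [exists u, [&& e == [set v; u], u != v & clu s u == Some c]]].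

Definition nbrs (s : bs_state) (v : 'I_n) : {set 'I_n} :=
  [set c | Eadj s v c != finset.set0].

Definition snbrs (i : nat) (s : bs_state) (v : 'I_n) : {set 'I_n} :=
  [set c in nbrs s v | (i <= lvl c)%N].

Definition in_sampled (i : nat) (s : bs_state) (v : 'I_n) : bool :=
  if clu s v is Some c then (i <= lvl c)%N else false.

Definition estar (i : nat) (s : bs_state) (v : 'I_n) : option {set 'I_n} :=
  least (\bigcup_(c in snbrs i s v) Eadj s v c).

Definition cstar (i : nat) (s : bs_state) (v : 'I_n) : option 'I_n :=
  [pick c in snbrs i s v | oapp (fun e => e \in Eadj s v c) false (estar i s v)].

Definition better (i : nat) (s : bs_state) (v c : 'I_n) : bool :=
  match least (Eadj s v c), estar i s v with
  | Some f, Some e => elt f e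
  | _, _ => false
  end.

Definition vadd (i : nat) (s : bs_state) (v : 'I_n) : {set {set 'I_n}} :=
  if in_sampled i s v then finset.set0
  else if snbrs i s v == finset.set0 then
    \bigcup_(c in nbrs s v) oset (least (Eadj s v c))
  else oset (estar i s v) :|:
       \bigcup_(c in nbrs s v | better i s v c) oset (least (Eadj s v c)).

Definition vrem (i : nat) (s : bs_state) (v : 'I_n) : {set {set 'I_n}} :=
  if in_sampled i s v then finset.set0
  else if snbrs i s v == finset.set0 then \bigcup_(c in nbrs s v) Eadj s v c
  else oapp (Eadj s v) finset.set0 (cstar i s v) :|:
       \bigcup_(c in nbrs s v | better i s v c) Eadj s v c.

Definition vclu (i : nat) (s : bs_state) (v : 'I_n) : option 'I_n :=
  if in_sampled i s v then clu s v
  else if snbrs i s v == finset.set0 then None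
  else cstar i s v.

Definition bs_iter (i : nat) (s : bs_state) : bs_state :=
  let clu' := [ffun v => vclu i s v] in
  let r1 := rest s :\: \bigcup_(v : 'I_n) vrem i s v in
  BSState clu'
    [set e in r1 | ~~ [exists u, exists x, exists c,
        [&& e == [set u; x], u != x, clu' u == Some c & clu' x == Some c]]]
    (span s :|: \bigcup_(v : 'I_n) vadd i s v).

Definition bs_spanner : {set {set 'I_n}} :=
  span (foldl (fun s i => bs_iter i s)
              (BSState [ffun v => Some v] E finset.set0) (iota 1 k)).

End BaswanaSen.

(* sampling probability p = n^(-1/k); S_0 = V, each S_i (1 <= i <= k-1)
   keeps each vertex of S_{i-1} independently with probability p.
   Pr[lvl v = i] = p^i (1 - p) for i < k-1 and p^(k-1) for i = k-1. *)
Definition bs_p (R : realType) (n k : nat) : R := n%:R `^ (- (k%:R)^-1).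

Definition lvl_prob (R : realType) (n k : nat) (lvl : {ffun 'I_n -> 'I_k}) : R :=
  \prod_(v : 'I_n) (bs_p R n k ^+ lvl v *
                    (if ((lvl v).+1 < k)%N then 1 - bs_p R n k else 1)).

(* worst case (over all choices made by the completion) number of edges
   added by the (k, k-1)-completion of the BS spanner with hierarchy lvl *)
Definition added (R : realType) (n k : nat) (E : {set {set 'I_n}})
    (w : {set 'I_n} -> R) (tb : {set 'I_n} -> nat) (lvl : {ffun 'I_n -> 'I_k})
    : nat :=
  let H0 := bs_spanner E w tb lvl in
  \max_(Hf : {set {set 'I_n}} | `[< completes w E k k.-1 H0 Hf >])
     #|Hf :\: H0|.

(* Main.v *)
(* Let H0 be the Baswana-Sen spanner and call an added edge e = uv missing, since it was
   added while dist_H(u, v) > k w(e). Missing edges survive the first k/2 iterations of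
   the clustering, so for i <= k/2 both ends lie within i w(e) of a center of S_i.

   Small k (up to O(log n)). Consider a completion step with missing edges e_1, ..., e_s
   in path order. Since dist_H(x, y) > k dist_G(x, y) + (k-1) Wmax, for every middle e_j the
   distance from the center of e_1, or that of e_s, to the center of e_j drops by at
   least (k-1) Wmax / 2; the levels of the centers are floor((k-1)/2) and floor(k/2), in an
   order depending on whether w(e_j) <= w(e_1) + w(e_s). Minimality of the segmentation
   forces a proportion of the e_j to have distinct centers, and keeps the distance of a
   pair of centers c, c' within (k+1)(k-1) Wmax of k dist_G(c, c') as long as the pair is
   used, so each pair is used O(k) times. The expected number of pairs is at most
   2 n^(1+1/k).

   Large k. At a fixed scale of weights, the missing edges form a graph without cycles of
   logarithmic length on the components of H0 at a scale smaller by a factor above n, since the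
   last edge added to a short cycle would not have been missing. Such a graph has
   linearly many edges, and each vertex matters for at most O(log n) scales because H0
   contains, for each edge e, a path of edges of weight at most w(e) joining its ends. *)
Require Import Defs.
From HB Require Import structures.
From mathcomp Require Import all_boot all_order all_algebra.
From mathcomp Require Import all_classical all_reals all_analysis.
From mathcomp Require Import zify ring lra.
Import Order.TTheory GRing.Theory Num.Theory.
Local Open Scope ring_scope.

Set Implicit Arguments.
Unset Strict Implicit.
Unset Printing Implicit Defensive.

(** * Distances *)

Section Distance.
Variables (R : realType) (n : nat) (w : {set 'I_n} -> R).
Implicit Types (F H : {set {set 'I_n}}) (x y z : 'I_n) (p q : seq 'I_n).

(** Real thresholds on the extended distance keep the later estimates within real arithmetic, even
    where the distance may be infinite. *)
Definition leD F x y (r : R) : bool := (dist w F x y <= r%:E)%E.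

Lemma plen_cat x p q : plen w x (p ++ q) = plen w x p + plen w (last x p) q.
Proof. by rewrite /plen pairmap_cat big_cat. Qed.

Lemma plen_cons x y p : plen w x (y :: p) = w [set x; y] + plen w y p.
Proof. by rewrite /plen /= big_cons. Qed.

Lemma walk_cat F x y z p q :
  walk F x y p -> walk F y z q -> walk F x z (p ++ q).
Proof.
move=> /andP[pp /eqP lp] /andP[pq /eqP lq].
by rewrite /walk cat_path last_cat pp lp pq lq eqxx.
Qed.

Lemma walk_rev F x y p : walk F x y p -> exists q,
  walk F y x q /\ plen w y q = plen w x p.
Proof.
elim: p x => [|z p IH] x; first by move=> /andP[_ /eqP /= <-]; exists [::]; rewrite /walk /= eqxx.
move=> /andP[/= /andP[xz pp] lp].
have [|q [wq lq]] := IH z; first by rewrite /walk pp.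
exists (q ++ [:: x]); split.
  by apply: walk_cat wq _; rewrite /walk /= finset.setUC xz eqxx.
rewrite plen_cat lq plen_cons; case/andP: wq => _ /eqP ->.
by rewrite plen_cons /plen big_nil addr0 addrC finset.setUC.
Qed.

Lemma leD_walk F x y p : walk F x y p -> leD F x y (plen w x p).
Proof. by move=> wp; apply: ereal_inf_lbound; exists p. Qed.

(** Working up to an arbitrary positive slack avoids showing that the infimum over walks is
    attained. *)
Lemma leDP F x y r :
  leD F x y r <-> forall e, 0 < e -> exists p, walk F x y p /\ plen w x p < r + e.
Proof.
split=> [ler e e0|H].
  have [|_ [p wp <-]] := @ereal_inf_lt R [set (plen w x p)%:E | p in [set p | walk F x y p]%classic]%classic (r + e)%:E.
    by apply: le_lt_trans ler _; rewrite lte_fin ltrDl.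
  by rewrite lte_fin => lp; exists p.
apply/lee_addgt0Pr => e e0; have [p [wp lp]] := H _ e0.
by apply: le_trans (leD_walk wp) _; rewrite -EFinD lee_fin ltW.
Qed.

Lemma leD_trans F y x z r s : leD F x y r -> leD F y z s -> leD F x z (r + s).
Proof.
move=> /leDP Hr /leDP Hs; apply/leDP => e e0.
have e20 : 0 < e / 2 by rewrite divr_gt0.
have [p [wp lp]] := Hr _ e20; have [q [wq lq]] := Hs _ e20.
exists (p ++ q); split; first exact: walk_cat wp wq.
rewrite plen_cat; case/andP: wp => _ /eqP ->.
by lra.
Qed.

Lemma leD_sym F x y r : leD F x y r -> leD F y x r.
Proof.
move=> /leDP Hr; apply/leDP => e e0; have [p [wp lp]] := Hr _ e0.
by have [q [wq lq]] := walk_rev wp; exists q; rewrite lq.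
Qed.

Lemma leD_le F x y r s : r <= s -> leD F x y r -> leD F x y s.
Proof. by move=> rs /le_trans; apply; rewrite lee_fin. Qed.

Lemma leD_refl F x : leD F x x 0.
Proof. by have := @leD_walk F x x [::]; rewrite /walk /= eqxx /plen big_nil; apply. Qed.

Lemma leD_edge F x y : [set x; y] \in F -> leD F x y (w [set x; y]).
Proof.
move=> xy; have := @leD_walk F x y [:: y].
by rewrite /walk /= eqxx xy plen_cons /plen big_nil addr0; apply.
Qed.

Lemma walk_sub F H x y p : F \subset H -> walk F x y p -> walk H x y p.
Proof.
move=> /fintype.subsetP FH /andP[pp lp]; rewrite /walk lp andbT.
by apply: sub_path pp => u v /FH.
Qed.

Lemma leD_sub F H x y r : F \subset H -> leD F x y r -> leD H x y r.
Proof.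
move=> FH /leDP Hr; apply/leDP => e /Hr[p [wp lp]].
by exists p; split=> //; apply: walk_sub wp.
Qed.

Lemma dist_ge0 F x y : (forall e, e \in F -> 0 <= w e) -> (0 <= dist w F x y)%E.
Proof.
move=> w0; apply: le_ereal_inf_tmp => _ [p /= /andP[pp _] <-]; rewrite lee_fin.
elim: p x pp => [|z p IH] x /=; first by rewrite /plen big_nil.
by case/andP=> xz pp; rewrite plen_cons addr_ge0 ?w0 ?IH.
Qed.

Lemma leD_fine F x y r : (forall e, e \in F -> 0 <= w e) -> leD F x y r ->
  forall s, leD F x y s = (fine (dist w F x y) <= s).
Proof.
move=> w0 ler s; have d0 := dist_ge0 x y w0; rewrite /leD -lee_fin fineK //.
by rewrite ge0_fin_numE //; apply: le_lt_trans ler _; rewrite ltry.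
Qed.

End Distance.

(** * The Baswana-Sen spanner *)

Lemma set2_eq (T : finType) (a b c d : T) :
  [set a; b] = [set c; d] -> (a = c /\ b = d) \/ (a = d /\ b = c).
Proof.
move=> e.
have : a \in [set c; d] by rewrite -e !inE eqxx.
have : b \in [set c; d] by rewrite -e !inE eqxx orbT.
have : c \in [set a; b] by rewrite e !inE eqxx.
have : d \in [set a; b] by rewrite e !inE eqxx orbT.
rewrite !inE => /orP[]/eqP-> /orP[]/eqP-> /orP[]/eqP hb /orP[]/eqP ha; subst; auto.
Qed.

(** * Walks bounded in number of hops and in edge weight *)

Section Hops.
Variables (R : realType) (n : nat) (w : {set 'I_n} -> R).
Implicit Types (F H : {set {set 'I_n}}) (x y z : 'I_n) (p q : seq 'I_n).

(** Finer than a length bound: the bound on each single edge is what later yields connectivity of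
    the light part of the spanner. *)
Definition hops F (om : R) m x y :=
  exists p, walk [set e in F | w e <= om] x y p /\ (size p <= m)%N.

Lemma hops_refl F om m x : hops F om m x x.
Proof. by exists [::]; rewrite /walk /= eqxx. Qed.

Lemma hops_trans F om m1 m2 x y z :
  hops F om m1 x y -> hops F om m2 y z -> hops F om (m1 + m2) x z.
Proof.
move=> [p [wp sp]] [q [wq sq]]; exists (p ++ q); split; first exact: walk_cat wp wq.
by rewrite size_cat leq_add.
Qed.

Lemma hops_sym F om m x y : hops F om m x y -> hops F om m y x.
Proof.
move=> [p [wp sp]].
suff [q [wq sq]] : exists q, walk [set e in F | w e <= om] y x q /\ size q = size p.
  by exists q; rewrite sq.
elim: p x {sp} wp => [|z p IH] x; first by move=> /andP[_ /eqP /= <-]; exists [::]; rewrite /walk /= eqxx.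
move=> /andP[/= /andP[xz pp] lp].
have [|q [wq lq]] := IH z; first by rewrite /walk pp.
exists (q ++ [:: x]); split; last by rewrite size_cat lq addn1.
by apply: walk_cat wq _; rewrite /walk /= finset.setUC xz eqxx.
Qed.

Lemma hops_mono F H om om' m m' x y : F \subset H -> om <= om' -> (m <= m')%N ->
  hops F om m x y -> hops H om' m' x y.
Proof.
move=> /fintype.subsetP FH oo mm [p [wp sp]]; exists p; split; last exact: leq_trans mm.
apply: walk_sub wp; apply/fintype.subsetP => e; rewrite !inE => /andP[/FH -> /=].
by move=> /le_trans; apply.
Qed.

Lemma hops_edge F om x y : [set x; y] \in F -> w [set x; y] <= om -> hops F om 1 x y.
Proof. by move=> xy wo; exists [:: y]; rewrite /walk /= eqxx !inE xy wo. Qed.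

Lemma hops_leD F om m x y : 0 <= om -> hops F om m x y -> leD w F x y (m%:R * om).
Proof.
move=> om0 [p [wp sp]].
have wF : walk F x y p by apply: walk_sub wp; apply/fintype.subsetP => e; rewrite inE => /andP[].
apply: leD_le (leD_walk w wF).
apply: (@le_trans _ _ ((size p)%:R * om)); last by rewrite ler_wpM2r // ler_nat.
elim: p x {wF sp} wp => [|z p IH] x; first by rewrite /plen big_nil mul0r.
move=> /andP[/= /andP[xz pp] lp]; rewrite plen_cons -nat1r mulrDl mul1r.
apply: lerD; first by move: xz; rewrite inE => /andP[].
by apply: IH; rewrite /walk pp.
Qed.

End Hops.

(** * Clusters, their radii and the stretch of removed edges *)

Section Clustering.
Variables (R : realType) (n k : nat) (E : {set {set 'I_n}})
  (w : {set 'I_n} -> R) (tb : {set 'I_n} -> nat) (lvl : {ffun 'I_n -> 'I_k}).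
Hypothesis E2 : forall e, e \in E -> #|e| = 2%N.
Implicit Types (s : bs_state n) (u v x y c : 'I_n) (e f : {set 'I_n}).

Local Notation elt := (elt w tb).
Local Notation least := (least w tb).
Local Notation estar := (estar w tb lvl).
Local Notation vadd := (vadd w tb lvl).
Local Notation vrem := (vrem w tb lvl).
Local Notation vclu := (vclu w tb lvl).

Lemma eltN e f : ~~ elt f e -> w e <= w f.
Proof. by rewrite /Defs.elt negb_or -leNgt => /andP[]. Qed.

(** The pick succeeds: minimise [w] first, then [tb] among the minimisers. *)
Lemma leastP A : A != finset.set0 ->
  exists e, [/\ least A = Some e, e \in A & forall f, f \in A -> w e <= w f].
Proof.
move=> /set0Pn[a aA]; rewrite /Defs.least; case: pickP => [e /andP[eA /fintype.forallP H]|none].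
  by exists e; split=> // f fA; apply: eltN; have := H f; rewrite fA.
case: (Order.TotalTheory.arg_minP w aA) => e eA emin.
have eB : e \in [set f in A | w f == w e] by rewrite inE eqxx andbT; exact: eA.
case: (arg_minnP tb eB) => g gB gmin.
have : g \in [set f in A | w f == w e] := gB.
rewrite inE => /andP[gA /eqP gw].
have := none g; rewrite gA /= => /negbT /negP[]; apply/fintype.forallP => f; apply/implyP => fA.
rewrite /Defs.elt gw negb_or -leNgt emin //= negb_and -leqNgt.
case: eqP => //= fw; have fB : f \in [set f in A | w f == w e] by rewrite inE fA fw eqxx.
exact: gmin.
Qed.

Lemma EadjP s v c e : reflect
  (e \in rest s /\ exists u, [/\ e = [set v; u], u != v & clu s u = Some c])
  (e \in Eadj s v c).
Proof.
rewrite /Eadj inE; apply: (iffP andP) => -[er].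
  by move=> /fintype.existsP[u /and3P[/eqP eu uv /eqP cu]]; split=> //; exists u.
by move=> [u [eu uv cu]]; split=> //; apply/fintype.existsP; exists u; rewrite eu uv cu !eqxx.
Qed.

Lemma nbrsP s v c e : e \in Eadj s v c -> c \in nbrs s v.
Proof. by move=> ev; rewrite inE; apply/set0Pn; exists e. Qed.

Lemma least_Eadj s v c : c \in nbrs s v -> exists f,
  [/\ least (Eadj s v c) = Some f, f \in Eadj s v c & forall e, e \in Eadj s v c -> w f <= w e].
Proof. by rewrite inE => /leastP[f [lf fE fm]]; exists f. Qed.

Lemma estarP i s v : snbrs lvl i s v != finset.set0 -> exists e c,
  [/\ estar i s v = Some e, cstar w tb lvl i s v = Some c, (i <= lvl c)%N,
      e \in Eadj s v c &
      forall f, f \in Eadj s v c -> w e <= w f].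
Proof.
move=> /set0Pn[c cs].
have : \bigcup_(c in snbrs lvl i s v) Eadj s v c != finset.set0.
  have := cs; rewrite !inE => /andP[/set0Pn[e ec] _].
  by apply/set0Pn; exists e; apply/bigcupP; exists c.
move=> /leastP[e [le ein emin]].
have ee : estar i s v = Some e by [].
have [c' c's ec'] := finset.bigcupP ein.
rewrite /cstar ee /=; case: pickP => [d /andP[ds ed]|/(_ c')]; last by rewrite c's ec'.
exists e, d; split=> //; first by move: ds; rewrite inE => /andP[].
by move=> f fd; apply: emin; apply/bigcupP; exists d.
Qed.

(** Edges from [v] to a cluster are only discarded together, when the least of them is added; for
    the cluster joined by [v] this least edge is [estar]. *)
Lemma vremP i s v e : e \in vrem i s v -> exists c f,
  [/\ e \in Eadj s v c, f \in Eadj s v c, f \in vadd i s v & w f <= w e].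
Proof.
rewrite /Defs.vrem /Defs.vadd; case: ifP => _; first by rewrite inE.
case: ifPn => [_ /bigcupP[c cn ec]|/estarP[es [c [ee ec _ esc emin]]]].
  have [f [lf fE fm]] := least_Eadj cn.
  exists c, f; split=> //; last exact: fm.
  by apply/bigcupP; exists c => //; rewrite lf inE.
rewrite ee ec inE => /orP[/= eE|/bigcupP[d /andP[dn db] ed]].
  by exists c, es; rewrite eE esc !inE eqxx; split=> //; apply: emin.
have [f [lf fE fm]] := least_Eadj dn.
exists d, f; split=> //; last exact: fm.
by rewrite inE; apply/orP; right; apply/bigcupP; exists d; rewrite ?dn // lf inE.
Qed.

(* Baswana and Sen's invariant after i iterations: an edge e still present joins clustered
   vertices, each at most i hops of weight at most w e away from its center. *)
Record bs_inv i s : Prop := BSInv {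
  inv_rest : rest s \subset E;
  inv_span : Defs.span s \subset E;
  inv_lvl : forall v c, clu s v = Some c -> (i <= lvl c)%N;
  inv_hops : forall x y, [set x; y] \in rest s ->
    exists2 c, clu s x = Some c & hops w (Defs.span s) (w [set x; y]) i x c }.

Section Iteration.
Variables (i : nat) (s : bs_state n).
Hypothesis inv_s : bs_inv i s.
Let s' := bs_iter w tb lvl i.+1 s.

Lemma vadd_rest v : vadd i.+1 s v \subset rest s.
Proof.
have lr c f : oset (least (Eadj s v c)) \subset rest s.
  rewrite /oset /Defs.least; case: pickP => [e /andP[/EadjP[er _] _]|_]; last exact: finset.sub0set.
  by rewrite finset.sub1set.
rewrite /Defs.vadd; case: ifP => _; first exact: finset.sub0set.
case: ifPn => [_|/estarP[e [c [-> _ _ /EadjP[er _] _]]]].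
  by apply/bigcupsP => c _; apply: lr; exact: finset.set0.
rewrite finset.subUset finset.sub1set er /=; apply/bigcupsP => d _.
by apply: lr; exact: finset.set0.
Qed.

Lemma span_iter : Defs.span s \subset Defs.span s'.
Proof. exact: finset.subsetUl. Qed.

Lemma vadd_span v : vadd i.+1 s v \subset Defs.span s'.
Proof.
apply: (fintype.subset_trans _ (finset.subsetUr _ _)).
exact: (finset.bigcup_sup v).
Qed.

(** The detour enters the cluster by the added edge, then climbs to its center and descends again in
    at most [i] hops each. By the invariant no edge used outweighs the removed one. *)
Lemma vrem_hops x y v : [set x; y] \in vrem i.+1 s v ->
  hops w (Defs.span s') (w [set x; y]) (2 * i + 1) x y.
Proof.
move=> /vremP[c [f [/EadjP[er [u [eu uv cu]]] /EadjP[fr [t [ft tv ct]]] fa fe]]].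
suff: hops w (Defs.span s') (w [set x; y]) (2 * i + 1) v u.
  by case: (set2_eq eu) => -[-> ->] // /hops_sym.
have [c1 cc1 hu] : exists2 c, clu s u = Some c & hops w (Defs.span s) (w [set u; v]) i u c.
  by apply: (inv_hops inv_s); rewrite finset.setUC -eu.
have [c2 cc2 ht] : exists2 c, clu s t = Some c & hops w (Defs.span s) (w [set t; v]) i t c.
  by apply: (inv_hops inv_s); rewrite finset.setUC -ft.
move: cc1 cc2 hu ht; rewrite cu ct => -[<-] [<-] hu ht.
have -> : (2 * i + 1 = 1 + (i + i))%N by lia.
apply: (@hops_trans _ _ _ _ _ _ _ _ t).
  apply: hops_edge; last by rewrite -ft.
  by rewrite -ft; apply: (fintype.subsetP (vadd_span v)).
apply: (@hops_trans _ _ _ _ _ _ _ _ c).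
  by apply: hops_mono ht => //; [exact: span_iter|rewrite finset.setUC -ft].
apply: hops_sym; apply: hops_mono hu => //; first exact: span_iter.
by rewrite finset.setUC -eu.
Qed.

(** If the cluster of [x] is not sampled, [x] joins a sampled cluster through [estar], one hop more.
    That edge is no heavier than the survivor: otherwise the cluster of [y] would be [better] and
    the survivor would have been removed. *)
Lemma survivor_hops x y : [set x; y] \in rest s ->
  (forall v, [set x; y] \notin vrem i.+1 s v) ->
  exists2 c, vclu i.+1 s x = Some c & hops w (Defs.span s') (w [set x; y]) i.+1 x c.
Proof.
move=> er nrem.
have [cx ccx hx] := inv_hops inv_s er.
have [cy ccy hy] : exists2 c, clu s y = Some c & hops w (Defs.span s) (w [set y; x]) i y c.
  by apply: (inv_hops inv_s); rewrite finset.setUC.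
have xy : x != y.
  by have := E2 (fintype.subsetP (inv_rest inv_s) _ er); rewrite cards2; case: eqP.
have ey : [set x; y] \in Eadj s x cy.
  by apply/EadjP; split=> //; exists y; rewrite eq_sym.
have := nrem x; rewrite /Defs.vrem /Defs.vclu; case: ifP => [sx _|nsx].
  by exists cx => //; apply: hops_mono hx => //; exact: span_iter.
case: ifPn => [_ /bigcupP[]|sn]; first by exists cy => //; apply: nbrsP ey.
have [es [c [ee ec lc esc emin]]] := estarP sn.
rewrite ec /= inE negb_or => /andP[_ nb]; exists c => //.
have wes : w es <= w [set x; y].
  rewrite leNgt; apply/negP => lt; move/bigcupP: nb; apply; exists cy => //.
  have cyn := nbrsP ey; rewrite cyn /better ee.
  have [f [lf fE fm]] := least_Eadj cyn.
  by rewrite lf /Defs.elt (le_lt_trans (fm _ ey) lt).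
have [esr [t [est tx ct]]] := EadjP _ _ _ _ esc.
have [c2 cc2 ht] : exists2 c, clu s t = Some c & hops w (Defs.span s) (w [set t; x]) i t c.
  by apply: (inv_hops inv_s); rewrite finset.setUC -est.
move: cc2 ht; rewrite ct => -[<-] ht.
rewrite -add1n; apply: (@hops_trans _ _ _ _ _ _ _ _ t).
  apply: hops_edge; rewrite -est //.
  apply: (fintype.subsetP (vadd_span x)); by rewrite /Defs.vadd nsx (negbTE sn) ee !inE eqxx.
by apply: hops_mono ht => //; [exact: span_iter|rewrite finset.setUC -est].
Qed.

Lemma rest_iter : rest s' \subset rest s.
Proof. by apply/fintype.subsetP => e; rewrite inE => /andP[]; rewrite inE => /andP[]. Qed.

Lemma vclu_lvl v c : vclu i.+1 s v = Some c -> (i < lvl c)%N.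
Proof.
rewrite /Defs.vclu; case: ifP => [|_].
  by rewrite /in_sampled; case: (clu s v) => // d ld [<-].
by case: ifPn => // /estarP[e [d [_ -> ld _ _]]] [<-].
Qed.

Lemma iter_inv : bs_inv i.+1 s'.
Proof.
split.
- exact: fintype.subset_trans rest_iter (inv_rest inv_s).
- rewrite finset.subUset (inv_span inv_s) /=; apply/bigcupsP => v _.
  exact: fintype.subset_trans (vadd_rest v) (inv_rest inv_s).
- by move=> v c; rewrite ffunE => /vclu_lvl.
move=> x y; rewrite inE => /andP[]; rewrite inE => /andP[nrem er] _.
have [v|c cx hx] := survivor_hops er; last by exists c; rewrite ?ffunE.
by apply: contra nrem => ev; apply/bigcupP; exists v.
Qed.

(** An edge is dropped at a vertex or because its ends now share a cluster. The second case needs a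
    center of level at least [i.+1], so it cannot occur in the last iteration. *)
Lemma removed_hops x y : [set x; y] \in rest s -> [set x; y] \notin rest s' ->
  hops w (Defs.span s') (w [set x; y]) (2 * i + 1) x y \/
  (i.+1 < k)%N /\ hops w (Defs.span s') (w [set x; y]) (2 * i.+1) x y.
Proof.
move=> er.
have [/fintype.existsP[v ev] _|/fintype.existsPn nrem] := boolP [exists v, [set x; y] \in vrem i.+1 s v].
  by left; apply: vrem_hops ev.
rewrite inE negb_and inE negb_and er orbF negbK => /orP[/negP[]|].
  by apply/negP/bigcupP => -[v _ ev]; have := nrem v; rewrite ev.
rewrite negbK => /fintype.existsP[u /fintype.existsP[t /fintype.existsP[c /and4P[/eqP eu ut /eqP cu /eqP ct]]]].
right; move: cu ct; rewrite !ffunE => cu ct.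
split; first exact: leq_ltn_trans (vclu_lvl cu) (ltn_ord _).
suff : hops w (Defs.span s') (w [set x; y]) (2 * i.+1) u t.
  by case: (set2_eq eu) => -[-> ->] // /hops_sym.
have -> : (2 * i.+1 = i.+1 + i.+1)%N by lia.
rewrite eu; rewrite eu in er nrem.
have [c1 cc1 h1] := survivor_hops er nrem.
have er2 := er; rewrite finset.setUC in er2.
have [v|c2 cc2 h2] := survivor_hops er2; first by rewrite finset.setUC.
move: cc1 cc2 h1 h2; rewrite cu ct => -[<-] [<-] h1 h2.
by apply: hops_trans h1 _; rewrite finset.setUC; apply: hops_sym.
Qed.

End Iteration.

Definition bs_state_at i : bs_state n :=
  foldl (fun s j => bs_iter w tb lvl j s)
    (BSState [ffun v => Some v] E finset.set0) (iota 1 i).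

Lemma bs_state_atS i : bs_state_at i.+1 = bs_iter w tb lvl i.+1 (bs_state_at i).
Proof. have iS : iota 1 i.+1 = iota 1 i ++ [:: i.+1] by rewrite -[i.+1]addn1 iotaD add1n addn1.
by rewrite /bs_state_at iS foldl_cat. Qed.

Lemma bs_state_inv i : bs_inv i (bs_state_at i).
Proof.
elim: i => [|i IH]; last by rewrite bs_state_atS; apply: iter_inv.
split=> //=; first exact: finset.sub0set.
by move=> x y _; exists x; rewrite ?ffunE //; apply: hops_refl.
Qed.

Lemma bs_span_mono i j : (i <= j)%N ->
  Defs.span (bs_state_at i) \subset Defs.span (bs_state_at j).
Proof.
move=> /subnK <-; elim: (j - i)%N => //= d IH.
by apply: fintype.subset_trans IH _; rewrite bs_state_atS; apply: span_iter.
Qed.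

Local Notation H0 := (bs_spanner E w tb lvl).

Lemma bs_spanner_sub : H0 \subset E.
Proof. exact: inv_span (bs_state_inv k). Qed.

Lemma bs_rest_k : rest (bs_state_at k) = finset.set0.
Proof.
apply/finset.setP => e; rewrite inE; apply/negbTE/negP => ek.
have eE := fintype.subsetP (inv_rest (bs_state_inv k)) _ ek.
have /eqP/cards2P[x [y [xy exy]]] := E2 eE.
rewrite exy in ek; have [c cx _] := inv_hops (bs_state_inv k) ek.
by have := inv_lvl (bs_state_inv k) cx; rewrite leqNgt ltn_ord.
Qed.

(** A removal in iteration [j.+1], with [j < i], costs at most [2 * j.+1] hops; the even value
    [2 * k] is excluded because the last iteration drops no edge inside a cluster. *)
Lemma bs_removed i x y : (i <= k)%N -> [set x; y] \in E ->
  [set x; y] \notin rest (bs_state_at i) ->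
  exists m, [/\ (m <= 2 * i)%N, (m < 2 * k)%N & hops w H0 (w [set x; y]) m x y].
Proof.
move=> ik eE; elim: i ik => [|i IH] ik nr; first by rewrite eE in nr.
have [er|] := boolP ([set x; y] \in rest (bs_state_at i)); last first.
  by move=> /(IH (ltnW ik))[m [m1 m2 hm]]; exists m; split=> //; lia.
rewrite bs_state_atS in nr.
have [h|[ik' h]] := removed_hops (bs_state_inv i) er nr; [exists (2 * i + 1)%N|exists (2 * i.+1)%N]; split; try lia.
  by apply: hops_mono h => //; rewrite -bs_state_atS; apply: bs_span_mono.
by apply: hops_mono h => //; rewrite -bs_state_atS; apply: bs_span_mono.
Qed.

Lemma bs_stretch x y : [set x; y] \in E ->
  hops w H0 (w [set x; y]) (2 * k).-1 x y.
Proof.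
move=> eE; have [|m [_ m2 hm]] := bs_removed (leqnn k) eE; first by rewrite bs_rest_k inE.
by apply: hops_mono hm => //; lia.
Qed.

Definition cluster_center i v := odflt v (clu (bs_state_at i) v).

Hypothesis w0 : forall e, e \in E -> 0 <= w e.

(** Had the edge been removed within [i] iterations, a detour of at most [2 * i <= k] hops would
    contradict its being far. So it is still present, and the clustering invariant applies. *)
Lemma bs_cluster_center x y i : [set x; y] \in E ->
  ~~ leD w H0 x y (k%:R * w [set x; y]) -> (2 * i <= k)%N ->
  (i <= lvl (cluster_center i x))%N /\ leD w H0 x (cluster_center i x) (i%:R * w [set x; y]).
Proof.
move=> eE far ik.
have er : [set x; y] \in rest (bs_state_at i).
  apply/negPn/negP => nr; have [|m [m1 _ hm]] := bs_removed _ eE nr; first lia.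
  move/negP: far; apply; apply: leD_le (hops_leD (w0 eE) hm).
  by rewrite ler_wpM2r ?w0 // ler_nat; lia.
have [c cx hx] := inv_hops (bs_state_inv i) er; rewrite /cluster_center cx /=.
split; first exact: inv_lvl (bs_state_inv i) _ _ cx.
apply: hops_leD; first exact: w0.
by apply: hops_mono hx => //; apply: bs_span_mono; lia.
Qed.

End Clustering.

(** * Completion steps *)

Lemma all_zip_behead (Q : pred (nat * nat)) (s : seq nat) :
  reflect (forall a, (a.+1 < size s)%N -> Q (nth 0%N s a, nth 0%N s a.+1))
          (all Q (zip s (behead s))).
Proof.
elim: s => [|u [|v t] IH] /=; [exact: ReflectT|exact: ReflectT|].
apply: (iffP andP) => [[quv /IH H] [|a] //= la|H]; first by apply: H; move: la; rewrite !ltnS.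
by split; [exact: (H 0%N)|apply/IH => a la; apply: (H a.+1)].
Qed.

Lemma has_zip_behead (Q : pred (nat * nat)) (s : seq nat) :
  reflect (exists2 a, (a.+1 < size s)%N & Q (nth 0%N s a, nth 0%N s a.+1))
          (has Q (zip s (behead s))).
Proof.
have -> : has Q (zip s (behead s)) = ~~ all (predC Q) (zip s (behead s)).
  by rewrite all_predC negbK.
apply: (iffP idP) => [|[a la qa]]; last first.
  by apply/negP => /all_zip_behead /(_ a la); rewrite /= qa.
move=> nall; apply: contrapT => nex; move/negP: nall; apply.
by apply/all_zip_behead => a la /=; apply/negP => qa; apply: nex; exists a.
Qed.

Section Steps.
Variables (R : realType) (n : nat) (w : {set 'I_n} -> R) (E : {set {set 'I_n}}).
Variables (alpha beta : nat).
Hypothesis w0 : forall e, e \in E -> 0 < w e.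
Implicit Types (H : {set {set 'I_n}}) (x y : 'I_n) (p : seq 'I_n).

(* What the completion knows about one step: the breakpoints X 0, ..., X m of the
   segmentation, their positions ps along the shortest path, and the segments
   [X a, X (a+1)] that are missing edges. *)
Record segmented H H' m (X : nat -> 'I_n) (ps : nat -> R) (bad : pred nat) : Prop :=
  Segmented {
  seg_mono : forall a b, (a < b)%N -> (b <= m)%N -> ps a < ps b;
  seg_dist : forall a b r, (a <= b)%N -> (b <= m)%N ->
    leD w E (X a) (X b) r = (ps b - ps a <= r);
  seg_good : forall a, (a < m)%N -> ~~ bad a ->
    leD w H (X a) (X a.+1) (alpha%:R * (ps a.+1 - ps a));
  seg_lt : forall a, bad a -> (a < m)%N;
  seg_edge : forall a, bad a -> [set X a; X a.+1] \in E;
  seg_w : forall a, bad a -> w [set X a; X a.+1] = ps a.+1 - ps a;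
  seg_bad : forall a, bad a ->
    ~~ leD w H (X a) (X a.+1) (alpha%:R * (ps a.+1 - ps a));
  seg_min : forall a b, (a.+2 <= b)%N -> (b <= m)%N ->
    ~~ leD w H (X a) (X b) (alpha%:R * (ps b - ps a));
  seg_viol : ~~ leD w H (X 0%N) (X m)
    (alpha%:R * (ps m - ps 0%N) + beta%:R * Wmax w E);
  seg_add : forall e, e \in H' <-> e \in H \/ exists2 a, bad a & e = [set X a; X a.+1] }.

Section Path.
Variables (x y : 'I_n) (p : seq 'I_n).
Hypothesis sp : shortest w E x y p.

Let pos i := plen w x (take i p).

Lemma pv_last i : (i <= size p)%N -> pv x p i = last x (take i p).
Proof.
move=> ip; rewrite /pv (last_nth x) size_takel //.
by rewrite -[x :: take i p]/(take i.+1 (x :: p)) nth_take.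
Qed.

Lemma pos_sub i j : (i <= j)%N -> (j <= size p)%N ->
  walk E (pv x p i) (pv x p j) (drop i (take j p)) /\
  plen w (pv x p i) (drop i (take j p)) = pos j - pos i.
Proof.
move=> ij jp; have [/andP[pp /eqP lp] _] := sp.
have e : take j p = take i p ++ drop i (take j p).
  by rewrite -[LHS](cat_take_drop i) take_takel.
have ip := leq_trans ij jp.
have pj : path (fun u v => [set u; v] \in E) x (take j p).
  by move: pp; rewrite -{1}(cat_take_drop j p) cat_path => /andP[].
rewrite !pv_last //; split; last by rewrite /pos e plen_cat -e addrAC subrr add0r.
rewrite /walk; move: pj; rewrite {1}e cat_path => /andP[_ ->] /=.
by rewrite [in X in _ == X]e last_cat.
Qed.

(** Subpaths of a shortest path are shortest: a shortcut could be spliced between the initial and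
    final parts. *)
Lemma pos_dist i j r : (i <= j)%N -> (j <= size p)%N ->
  leD w E (pv x p i) (pv x p j) r = (pos j - pos i <= r).
Proof.
move=> ij jp; have [/andP[pp /eqP lp] dxy] := sp.
have [wij lij] := pos_sub ij jp.
apply/idP/idP => [ler|lr]; last by apply: leD_le lr _; rewrite -lij; apply: leD_walk.
have [w1 l1] := pos_sub (leq0n i) (leq_trans ij jp).
have [w2 l2] := pos_sub jp (leqnn _).
have := leD_trans (leD_trans (leD_walk w w1) ler) (leD_walk w w2).
have -> : pv x p (size p) = y by rewrite pv_last // take_size.
rewrite -[pv x p 0]/x /leD -dxy lee_fin l2 l1 /pos take_size take0.
by rewrite /(plen w x [::]) big_nil; lra.
Qed.

Lemma pos_distE i j : (i <= j)%N -> (j <= size p)%N ->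
  dist w E (pv x p i) (pv x p j) = (pos j - pos i)%:E.
Proof.
move=> ij jp; apply/eqP; rewrite eq_le; apply/andP; split.
  by have := pos_dist (pos j - pos i) ij jp; rewrite lexx.
apply: le_ereal_inf_tmp => _ [q /= wq <-]; rewrite lee_fin -pos_dist //.
exact: leD_walk.
Qed.

Lemma pos_edge i : (i < size p)%N -> [set pv x p i; pv x p i.+1] \in E /\
  w [set pv x p i; pv x p i.+1] = pos i.+1 - pos i.
Proof.
move=> ip; have [wi li] := pos_sub (leqnSn i) ip.
have e : drop i (take i.+1 p) = [:: pv x p i.+1].
  by rewrite (take_nth x) // -cats1 drop_size_cat // size_takel // ltnW.
move: wi li; rewrite e plen_cons /plen big_nil addr0 => /andP[/= /andP[he _] _] le.
by split.
Qed.

Lemma pos_mono i j : (i < j)%N -> (j <= size p)%N -> pos i < pos j.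
Proof.
elim: j => // j IH; rewrite ltnS leq_eqVlt => /orP[/eqP ->|ij] jp;
  have [/w0 + wj] := pos_edge jp; rewrite wj; first by lra.
by have := IH ij (ltnW jp); lra.
Qed.

End Path.

Lemma merge_aseg H x p I a b : is_aseg w E alpha H x p I ->
  (a.+2 <= b)%N -> (b < size I)%N ->
  (dist w H (pv x p (nth 0%N I a)) (pv x p (nth 0%N I b)) <=
    (alpha%:R)%:E * dist w E (pv x p (nth 0%N I a)) (pv x p (nth 0%N I b)))%E ->
  is_aseg w E alpha H x p (take a.+1 I ++ drop b I).
Proof.
move=> /and4P[hI lI sI /all_zip_behead aI] ab bI hab; apply/and4P; split.
- by move: hI; case: (I).
- by rewrite last_cat; move: lI; rewrite -{1}(cat_take_drop b I) last_cat;
    rewrite (drop_nth 0%N bI).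
- apply: (subseq_sorted _ _ sI); first exact: ltn_trans.
  rewrite -[X in subseq _ X](cat_take_drop b I); apply: cat_subseq => //.
  rewrite -(@take_takel _ a.+1 b) ?take_subseq //; lia.
have sa : size (take a.+1 I) = a.+1 by rewrite size_takel //; lia.
have nJ c : nth 0%N (take a.+1 I ++ drop b I) c =
    if (c <= a)%N then nth 0%N I c else nth 0%N I (b + (c - a.+1)).
  by rewrite nth_cat sa ltnS; case: ifP => ca; rewrite ?nth_take ?nth_drop.
apply/all_zip_behead => c; rewrite size_cat sa size_drop => cs /=.
(* Segment [c] lies before the merged one, after it (a shifted segment of [I]), or is the merged one
   itself. *)
rewrite !nJ; have [ca|ac|->] := ltngtP c a.
- by apply: (aI c); lia.
- have -> : (b + (c.+1 - a.+1) = (b + (c - a.+1)).+1)%N by lia.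
  by apply: aI; lia.
by rewrite subnn addn0 hab implybT.
Qed.

Lemma cstepE H H' : cstep w E alpha beta H H' ->
  exists m X ps bad, segmented H H' m X ps bad.
Proof.
move=> [x [y [vxy [p [I [sp [[aseg mI] ->]]]]]]].
have /and4P[hI lI sI /all_zip_behead aI] := aseg.
pose m := (size I).-1; pose i a := nth 0%N I a.
have I0 : (0 < size I)%N by case: (I) hI.
have sIm : size I = m.+1 by rewrite prednK.
have i0 : i 0%N = 0%N by rewrite /i; case: (I) hI => //= ? ? /eqP.
have im : i m = size p by rewrite /i nth_last; apply/eqP.
have imono a b : (a < b)%N -> (b <= m)%N -> (i a < i b)%N.
  by move=> ab bm; apply: (sorted_ltn_nth ltn_trans) => //; rewrite inE; lia.
have imono' a b : (a <= b)%N -> (b <= m)%N -> (i a <= i b)%N.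
  by rewrite leq_eqVlt => /orP[/eqP->//|ab bm]; apply/ltnW/imono.
have ip a : (a <= m)%N -> (i a <= size p)%N by move=> am; rewrite -im; apply: imono'.
pose bad a := [&& (a < m)%N, i a.+1 == (i a).+1 &
  ((alpha%:R)%:E * (w [set pv x p (i a); pv x p (i a.+1)])%:E
     < dist w H (pv x p (i a)) (pv x p (i a.+1)))%E].
exists m, (fun a => pv x p (i a)), (fun a => plen w x (take (i a) p)), bad.
split.
- by move=> a b ab bm; apply: (pos_mono sp); rewrite ?imono ?ip.
- by move=> a b r ab bm; apply: (pos_dist sp); rewrite ?imono' ?ip.
- move=> a am nb; have : (a.+1 < size I)%N by rewrite sIm ltnS.
  move=> /(aI a) /implyP; rewrite /= -!/(i _).
  have lt := imono _ _ (ltnSn a) am.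
  (* Segments of at least two edges are good by the segmentation condition; one-edge segments are
     good because they are not [bad]. *)
  have [le /(_ isT)|le _] := leqP (i a).+2 (i a.+1).
    by rewrite (pos_distE sp) ?ip ?(ltnW lt) // -EFinM.
  have e : i a.+1 = (i a).+1 by lia.
  have [|_ we] := pos_edge sp (i := i a); first by rewrite -e ip.
  by move: nb; rewrite /bad am e eqxx /= -leNgt we -EFinM.
- by move=> a /andP[].
- move=> a /and3P[am /eqP e _]; rewrite e.
  by have [|] := pos_edge sp (i := i a); first by rewrite -e ip.
- move=> a /and3P[am /eqP e _]; rewrite e.
  by have [|] := pos_edge sp (i := i a); first by rewrite -e ip.
- move=> a /and3P[am /eqP e]; rewrite e.
  have [|_ we] := pos_edge sp (i := i a); first by rewrite -e ip.
  by rewrite we -EFinM ltNge.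
(* Minimality: a close pair of breakpoints at least two segments apart could be merged. *)
- move=> a b ab bm; apply/negP => lab.
  have := mI a b ab; rewrite sIm ltnS => /(_ bm) /negP; apply.
  apply: merge_aseg => //; first by rewrite sIm.
  by rewrite -!/(i _) (pos_distE sp) ?ip ?imono' ?(ltnW (ltnW ab)) // -EFinM.
- move: vxy; rewrite /viol /leD -ltNge /= i0 im.
  have -> : y = pv x p (size p).
    by rewrite pv_last // take_size; have [/andP[_ /eqP]] := sp.
  by rewrite -[x in dist w E x]/(pv x p 0) (pos_distE sp).
move=> e; rewrite inE; split.
  move=> /orP[->|]; [by left|rewrite inE => /has_zip_behead[a]].
  rewrite sIm ltnS => am /= /and3P[e1 /eqP e2 e3]; right.
  by exists a => //; rewrite {}e2 in e3 *; apply/and3P; split.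
move=> [->//|[a /and3P[am e1 e3] ->]]; apply/orP; right.
by rewrite inE; apply/has_zip_behead; exists a; rewrite ?sIm // -!/(i _) e1 eqxx e3.
Qed.

End Steps.

(** * Graphs without short cycles *)

Section Moore.
Variables (V T : finType) (src tgt : T -> V) (F : {set T}) (L : nat).

Definition crosses (chi : V -> bool) (e : T) := chi (src e) != chi (tgt e).

(* A set of edges crossed exactly once by some cut contains no cycle through the
   crossing edge, so this says that there are no cycles of length at most 2 L + 1. *)
Hypothesis no_short_cycle : forall Z : {set T}, Z \subset F -> Z != finset.set0 ->
  (#|Z| <= (2 * L).+1)%N -> exists chi f,
  [/\ f \in Z, crosses chi f & forall e, e \in Z -> e != f -> ~~ crosses chi e].

Local Notation F2 := 'F_2.

Let bdry (z : T -> F2) (chi : V -> F2) := \sum_e z e * (chi (src e) + chi (tgt e)).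
Let supp (z : T -> F2) : {set T} := [set e | z e != 0].
Let delta (e : T) : T -> F2 := fun f => (f == e)%:R.

(** A chain over F_2 with at most [r] edges and boundary v + x, the boundary being tested against
    all functions [chi]. Sums of such chains need no bookkeeping of walks. *)
Definition path_vector r v x (z : T -> F2) :=
  [/\ supp z \subset F, (#|supp z| <= r)%N &
      forall chi, bdry z chi = chi v + chi x].

Let addF2 (x : F2) : x + x = 0.
Proof. by rewrite -mulr2n -mulr_natr pchar_Fp_0 ?mulr0. Qed.

Let bdryD z1 z2 chi : bdry (fun e => z1 e + z2 e) chi = bdry z1 chi + bdry z2 chi.
Proof. by rewrite /bdry -big_split; apply: eq_bigr => e _; rewrite mulrDl. Qed.

Let bdry_delta e chi : bdry (delta e) chi = chi (src e) + chi (tgt e).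
Proof.
rewrite /bdry (bigD1 e) //= big1 => [|f /negbTE fe]; last by rewrite /delta fe mul0r.
by rewrite /delta eqxx mul1r addr0.
Qed.

Let suppD z1 z2 : supp (fun e => z1 e + z2 e) \subset supp z1 :|: supp z2.
Proof.
apply/fintype.subsetP => e; rewrite !inE; apply: contraR.
by rewrite negb_or !negbK => /andP[/eqP-> /eqP->]; rewrite addr0.
Qed.

Let supp_delta e : supp (delta e) = [set e].
Proof. by apply/finset.setP => f; rewrite !inE /delta; case: (f == e); rewrite ?oner_eq0 ?eqxx. Qed.

Lemma path_vector_refl v : path_vector 0 v v (fun=> 0).
Proof.
have s0 : supp (fun=> 0) = finset.set0 by apply/finset.setP => e; rewrite !inE eqxx.
split; rewrite ?s0 ?finset.sub0set ?cards0 // => chi.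
by rewrite addF2 /bdry big1 // => e _; rewrite mul0r.
Qed.

Lemma path_vector_step r v x y z e : path_vector r v x z -> e \in F ->
  (src e = x /\ tgt e = y) \/ (src e = y /\ tgt e = x) ->
  path_vector r.+1 v y (fun f => z f + delta e f).
Proof.
move=> [sF sr bz] eF exy; split.
- apply: fintype.subset_trans (suppD _ _) _.
  by rewrite finset.subUset sF supp_delta finset.sub1set.
- apply: leq_trans (subset_leq_card (suppD _ _)) _.
  by apply: leq_trans (leq_card_setU _ _) _; rewrite supp_delta cards1 addn1.
move=> chi; rewrite bdryD bz bdry_delta -addrA; congr (_ + _).
by case: exy => -[-> ->]; rewrite ?[chi y + _]addrC addrA addF2 add0r.
Qed.

Definition inner (A : {set V}) := [set e in F | (src e \in A) && (tgt e \in A)].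

(* Over F_2 the edges of a ball without short cycles are sums of at most #|A| path
   vectors, hence there are at most #|A| of them. *)
Lemma card_inner_ball v (A : {set V}) :
  (forall x, x \in A -> exists z, path_vector L v x z) -> (#|inner A| <= #|A|)%N.
Proof.
move=> pA.
have /choice[phi Hphi] : forall x, exists z, x \in A -> path_vector L v x z.
  move=> x; have [/pA[z pz]|] := boolP (x \in A); first by exists z.
  by exists (fun=> 0).
(* The two path vectors and the edge add up to a cycle with at most [2 * L + 1] edges, which must be
   zero. *)
have key e f : e \in inner A -> phi (src e) f + phi (tgt e) f = delta e f.
  rewrite !inE => /and3P[eF /Hphi[sF1 s1 b1] /Hphi[sF2 s2 b2]].
  pose z f := (phi (src e) f + phi (tgt e) f) + delta e f.
  suff : z f = 0.
    by rewrite /z => zf; rewrite -[LHS]addr0 -(addF2 (delta e f)) addrA zf add0r.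
  apply/eqP/negPn/negP => zf.
  have zs : supp z \subset (supp (phi (src e)) :|: supp (phi (tgt e))) :|: [set e].
    apply: fintype.subset_trans (suppD _ _) _.
    by rewrite supp_delta finset.setSU.
  have [| | |chi [g [gz gc gu]]] := no_short_cycle (Z := supp z).
  - apply: fintype.subset_trans zs _.
    by rewrite !finset.subUset sF1 sF2 finset.sub1set.
  - by apply/set0Pn; exists f; rewrite inE.
  - apply: leq_trans (subset_leq_card zs) _.
    apply: leq_trans (leq_card_setU _ _) _; rewrite cards1 addn1 ltnS.
    by apply: leq_trans (leq_card_setU _ _) _; rewrite mul2n -addnn leq_add.
  (* Pairing the boundary of [z], which is zero, with the cut leaves only the coefficient at [g],
     which is nonzero. *)
  pose c x : F2 := (chi x)%:R.
  have cE h : c (src h) + c (tgt h) = (crosses chi h)%:R.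
    by rewrite /c /crosses; case: (chi _); case: (chi _); rewrite ?addF2 ?addr0 ?add0r.
  have : bdry z c = 0.
    rewrite bdryD bdryD b1 b2 bdry_delta.
    have -> : (c v + c (src e) + (c v + c (tgt e)) + (c (src e) + c (tgt e)) =
      (c v + c v) + (c (src e) + c (src e)) + (c (tgt e) + c (tgt e))) by ring.
    by rewrite !addF2.
  rewrite /bdry (bigD1 g) //= cE gc mulr1 big1 => [|h hg].
    by rewrite addr0 => zg; rewrite inE zg eqxx in gz.
  have [hz|] := boolP (h \in supp z); last by rewrite inE negbK => /eqP ->; rewrite mul0r.
  by rewrite cE (negbTE (gu h hz hg)) mulr0.
pose ev (i : 'I_#|inner A|) := enum_val i.
(* By [key], the incidence matrix [B] times [Phi] is the identity, which therefore factors through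
   dimension [#|A|]. *)
pose B : 'M[F2]_(#|inner A|, #|A|) := \matrix_(i, j)
  ((enum_val j == src (ev i))%:R + (enum_val j == tgt (ev i))%:R).
pose Phi : 'M[F2]_(#|A|, #|inner A|) := \matrix_(j, i) phi (enum_val j) (ev i).
apply: (@mulmx1_min _ _ _ B Phi); apply/matrixP => i i'; rewrite !mxE.
under eq_bigr do rewrite !mxE.
rewrite -(big_enum_val (fun x => ((x == src (ev i))%:R + (x == tgt (ev i))%:R) * phi x (ev i'))).
have eA := enum_valP i; have := eA; rewrite inE => /and3P[_ sA tA].
under eq_bigr do rewrite mulrDl.
have pick a : a \in A -> \sum_(x in A) (x == a)%:R * phi x (ev i') = phi a (ev i').
  move=> aA; rewrite (bigD1 a) //= eqxx mul1r big1 ?addr0 // => x /andP[_ /negbTE ->].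
  by rewrite mul0r.
rewrite big_split /= !pick // key // /delta; congr (_%:R).
by rewrite (inj_eq enum_val_inj) eq_sym.
Qed.

Section Ball.
Variables (U : {set V}) (v : V).

Fixpoint ball r : {set V} := if r is r'.+1 then
  ball r' :|: [set y in U | [exists e in inner U,
    ((src e \in ball r') && (tgt e == y)) || ((tgt e \in ball r') && (src e == y))]]
  else [set v].

Lemma ball_path_vector r x : x \in ball r ->
  exists r' z, (r' <= r)%N /\ path_vector r' v x z.
Proof.
elim: r x => [|r IH] x /=; first by rewrite inE => /eqP ->; exists 0%N, (fun=> 0); split=> //; exact: path_vector_refl.
rewrite inE => /orP[/IH[r' [z [rr pz]]]|]; first by exists r', z; split=> //; apply: leqW.
rewrite inE => /andP[_ /exists_inP[e]]; rewrite inE => /andP[eF _].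
move=> /orP[] /andP[/IH[r' [z [rr pz]]] /eqP ex]; exists r'.+1, (fun f => z f + delta e f); split=> //.
  by apply: path_vector_step pz eF _; left.
by apply: path_vector_step pz eF _; right.
Qed.

Lemma path_vector_le r r' x z : (r <= r')%N -> path_vector r v x z -> path_vector r' v x z.
Proof. by move=> rr [? s ?]; split=> //; apply: leq_trans s rr. Qed.

Lemma ball_sub r : v \in U -> ball r \subset U.
Proof.
move=> vU; elim: r => [|r IH] /=; first by rewrite finset.sub1set.
by rewrite finset.subUset IH; apply/fintype.subsetP => x; rewrite inE => /andP[].
Qed.

(** Otherwise the ball would more than double at each of [L] steps and outgrow [V]. *)
Lemma ball_growth : (#|V| < 2 ^ L)%N ->
  exists2 j, (j < L)%N & (#|ball j.+1| <= 2 * #|ball j|)%N.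
Proof.
move=> VL; apply: contrapT => nex.
suff H j : (j <= L)%N -> (2 ^ j <= #|ball j|)%N.
  by have := H L (leqnn _); rewrite leqNgt (leq_ltn_trans (max_card _) VL).
elim: j => [|j IH] jL; first by rewrite cards1.
rewrite expnS; apply: leq_trans (leq_mul (leqnn 2) (IH (ltnW jL))) _.
by rewrite leqNgt; apply/negP => lt; apply: nex; exists j => //; apply: ltnW.
Qed.

End Ball.

(** Peel off a slowly growing ball: every edge meeting [ball j] lies inside [ball j.+1], which has
    at most twice as many vertices as [ball j]. The remaining edges fall to induction on [#|U|]. *)
Lemma card_inner_le (U : {set V}) : (#|V| < 2 ^ L)%N -> (#|inner U| <= 2 * #|U|)%N.
Proof.
move=> VL; have [m] := ubnP #|U|; elim: m U => // m IH U; rewrite ltnS => Um.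
have [->|/set0Pn[v vU]] := eqVneq U finset.set0.
  apply: (@leq_trans 0) => //; rewrite leqn0 cards_eq0; apply/eqP/finset.setP => e.
  by rewrite !inE /= andbF.
have [j jL gr] := ball_growth U v VL.
have vb i : v \in ball U v i by elim: i => [|i IHi] /=; rewrite !inE ?eqxx ?IHi.
have bU := ball_sub j vU.
have sub : inner U \subset inner (ball U v j.+1) :|: inner (U :\: ball U v j).
  apply/fintype.subsetP => e eU; have := eU; rewrite inE => /and3P[eF sU tU].
  have [sb|sb] := boolP (src e \in ball U v j).
    rewrite inE; apply/orP; left; rewrite 2!inE eF /= inE sb /= 2!inE tU /=.
    by apply/orP; right; apply/exists_inP; exists e; rewrite ?sb ?eqxx.
  have [tb|tb] := boolP (tgt e \in ball U v j).
    rewrite inE; apply/orP; left; rewrite 2!inE eF /= 2!inE sU tb /= andbT.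
    by apply/orP; right; apply/exists_inP; exists e; rewrite ?tb ?eqxx ?orbT.
  by rewrite inE; apply/orP; right; rewrite !inE eF sU tU sb tb.
have c1 : (#|inner (ball U v j.+1)| <= 2 * #|ball U v j|)%N.
  apply: leq_trans gr; apply: (@card_inner_ball v) => x /ball_path_vector[r [z [rj pz]]].
  by exists z; apply: path_vector_le pz; lia.
have cU : #|U| = (#|ball U v j| + #|U :\: ball U v j|)%N.
  by rewrite -(cardsID (ball U v j) U) (finset.setIidPr bU).
have b0 : (0 < #|ball U v j|)%N by apply/card_gt0P; exists v.
have c2 : (#|inner (U :\: ball U v j)| <= 2 * #|U :\: ball U v j|)%N.
  by apply: IH; lia.
apply: leq_trans (subset_leq_card sub) _; apply: leq_trans (leq_card_setU _ _) _.
by rewrite cU mulnDr leq_add.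
Qed.

End Moore.

(** * Counting added edges for large k *)

Lemma sum_sub_le (R : numDomainType) (I : finType) (P Q : pred I) (F : I -> R) :
  (forall i, P i -> Q i) -> (forall i, Q i -> 0 <= F i) ->
  \sum_(i | P i) F i <= \sum_(i | Q i) F i.
Proof.
move=> PQ F0; rewrite [leRHS](bigID P) /=.
rewrite (eq_bigl (fun i => Q i && P i)); last first.
  by move=> i; case: (boolP (P i)) => [/PQ ->|_]; rewrite ?andbF.
by rewrite lerDl sumr_ge0 // => i /andP[/F0].
Qed.

(** * Cuts crossed exactly once by a set of added edges *)

Section Cuts.
Variables (R : realType) (n : nat) (w : {set 'I_n} -> R) (E : {set {set 'I_n}}).
Variables (k beta : nat) (H0 : {set {set 'I_n}}).
Hypothesis w0 : forall e, e \in E -> 0 < w e.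
Implicit Types (H Z : {set {set 'I_n}}) (x y : 'I_n).

Lemma completes_sub H Hf : completes w E k beta H Hf -> H \subset E -> Hf \subset E.
Proof.
elim=> // {H} H H' {}Hf st _ IH HE; apply: IH; apply/fintype.subsetP => e.
have [m [X [ps [bad sg]]]] := cstepE w0 st.
by move=> /(seg_add sg)[/(fintype.subsetP HE)//|[a /(seg_edge sg) + ->]].
Qed.

Lemma plen_uniq_path (theta : R) Z (g : rel 'I_n) x p : 0 <= theta ->
  (forall e, e \in Z -> 0 <= w e) ->
  (forall u v, g u v -> w [set u; v] <= theta \/ [set u; v] \in Z) ->
  path g x p -> uniq (x :: p) ->
  plen w x p <= n%:R * theta + \sum_(e in Z) w e.
Proof.
move=> t0 wZ gZ pp up.
have sp : ((size p)%:R <= n%:R :> R).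
  have : (size (x :: p) <= #|'I_n|)%N by rewrite -(card_uniqP up) max_card.
  by rewrite card_ord ler_nat => /ltnW.
have {sp} : (size p)%:R * theta <= n%:R * theta by rewrite ler_wpM2r.
(* Restricting the sum to edges spanned by the vertices of the path makes the induction count each
   edge of [Z] once: an edge at the first vertex is absent from the sum for the tail. *)
suff H : plen w x p <= (size p)%:R * theta +
    \sum_(e in Z | [forall v in e, v \in x :: p]) w e.
  have : \sum_(e in Z | [forall v in e, v \in x :: p]) w e <= \sum_(e in Z) w e.
    by apply: sum_sub_le => [e /andP[]|e /wZ].
  lra.
elim: p x pp up => [|z p IH] x.
  by move=> _ _; rewrite /plen big_nil mul0r add0r sumr_ge0 // => e /andP[/wZ].
move=> /= /andP[xz pp] /andP[xp up].
rewrite plen_cons -nat1r mulrDl mul1r.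
have := IH z pp up.
set S1 := \sum_(e in Z | _) _; set S2 := \sum_(e in Z | _) _.
have S12 : S1 <= S2.
  apply: sum_sub_le => [e /andP[-> /forall_inP H]|e /andP[/wZ]//] /=.
  by apply/forall_inP => v /H vz; rewrite in_cons vz orbT.
have [le|xzZ] := gZ _ _ xz; first by lra.
suff : w [set x; z] + S1 <= S2 by lra.
rewrite /S2 (bigD1 [set x; z]) /=; last first.
  rewrite xzZ; apply/forall_inP => v; rewrite !inE => /orP[]/eqP->; rewrite eqxx ?orbT //.
rewrite lerD2l; apply: sum_sub_le => [e /andP[-> /forall_inP H]|e /andP[/andP[/wZ]]//] /=.
apply/andP; split; first by apply/forall_inP => v /H vz; rewrite in_cons vz orbT.
by apply/eqP => exz; have := H x; rewrite exz !inE eqxx => /(_ isT); rewrite -in_cons (negbTE xp).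
Qed.

Definition light (theta : R) : rel 'I_n :=
  [rel x y | ([set x; y] \in H0) && (w [set x; y] <= theta)].

(* The cut isolates an endpoint of the missing edge of Z lying first on the path of
   the last completion step that adds an edge of Z; by minimality of the
   segmentation the later missing edges of that step do not cross it. *)
Lemma single_crossing H Hf Z (M theta : R) :
  completes w E k beta H Hf -> H0 \subset H -> 0 <= theta ->
  Z \subset Hf -> ~~ (Z \subset H) -> 0 < M ->
  (forall e, e \in Z -> M <= w e) ->
  n%:R * theta + \sum_(e in Z) w e <= k%:R * M ->
  exists (chi : 'I_n -> bool) f, [/\ f \in Z,
    (forall x y, light theta x y -> chi x = chi y),
    (forall x y, f = [set x; y] -> chi x != chi y) &
    (forall e x y, e \in Z -> e != f -> e = [set x; y] -> chi x = chi y)].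
Proof.
move=> cH + t0 ZHf + M0 ZM short.
elim: cH ZHf => {H Hf} [H _|H H' Hf st cH' IH] ZHf H0H ZH; first by rewrite ZHf in ZH.
have [m [X [ps [bad sg]]]] := cstepE w0 st.
have HH' : H \subset H' by apply/fintype.subsetP => e eH; apply/(seg_add sg); left.
(* Advance to the step that completes [Z]. *)
have [ZH'|ZH'] := boolP (Z \subset H'); last first.
  by apply: IH => //; apply: fintype.subset_trans H0H HH'.
have : exists a, bad a && ([set X a; X a.+1] \in Z :\: H).
  have /subsetPn[e eZ eH] := ZH.
  have /(seg_add sg)[|[a ba ea]] := fintype.subsetP ZH' _ eZ; first by rewrite (negbTE eH).
  by exists a; rewrite ba -ea inE eH eZ.
move=> ex; case: (ex_minnP ex) => a /andP[ba]; rewrite inE => /andP[aH aZ] amin.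
(* The component of [X a] under [g] stays within k M of [X a] in [H], whereas badness and minimality
   put every later breakpoint beyond that distance. *)
pose g := [rel x y | light theta x y || ([set x; y] \in Z :&: H)].
have gsym : symmetric g by move=> x y; rewrite /= /light /= finset.setUC.
have csym := sym_connect_sym gsym.
exists (connect g (X a)), [set X a; X a.+1].
have wZ e : e \in Z -> 0 <= w e by move=> /ZM; lra.
have near_a y : connect g (X a) y -> leD w H (X a) y (k%:R * M).
  move=> /connectP[q pq ->]; case/shortenP: pq => q' pq' uq' _.
  have wq' : walk H (X a) (last (X a) q') q'.
    rewrite /walk eqxx andbT; apply: sub_path pq' => u v /orP[/andP[uv _]|].
      exact: (fintype.subsetP H0H).
    by rewrite inE => /andP[].
  apply: leD_le (leD_walk w wq'); apply: le_trans short.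
  apply: (plen_uniq_path (g := g)) => // u v /orP[/andP[_ lt]|]; first by left.
  by rewrite inE => /andP[uZ _]; right.
have far y : ~~ leD w H (X a) y (k%:R * M) -> connect g (X a) y = false.
  by move=> ny; apply: contraNF ny => /near_a.
have Ma : M <= ps a.+1 - ps a by rewrite -(seg_w sg ba); apply: ZM.
have farps b : (a < b)%N -> (b <= m)%N -> connect g (X a) (X b) = false.
  move=> ab bm; apply: far.
  have le_a : k%:R * M <= k%:R * (ps b - ps a).
    rewrite ler_wpM2l //; have [lt|gt|eb] := ltngtP a.+1 b; last by rewrite -eb.
      by have := seg_mono sg lt bm; lra.
    by move: gt; rewrite ltnS leqNgt ab.
  apply: contra (leD_le le_a) _.
  have [eb|lt] := eqVneq b a.+1; first by rewrite eb; apply: (seg_bad sg ba).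
  by apply: (seg_min sg _ bm); rewrite ltn_neqAle eq_sym lt ab.
have conn_eq x y : g x y -> connect g (X a) x = connect g (X a) y.
  by move=> xy; rewrite ![connect g (X a) _]csym; apply: (same_connect1 csym).
have am := seg_lt sg ba.
split=> //.
- by move=> x y xy; apply: conn_eq; rewrite /= xy.
- by move=> x y /set2_eq[[<- <-]|[<- <-]]; rewrite connect0 farps.
move=> e x y eZ ea exy; have [eH|eH] := boolP (e \in H).
  by apply: conn_eq; rewrite /= inE -exy eZ eH orbT.
have /(seg_add sg)[|[b bb eb]] := fintype.subsetP ZH' _ eZ; first by rewrite (negbTE eH).
have ab : (a < b)%N.
  rewrite ltn_neqAle amin ?andbT; first by apply: contraNneq ea => ->; rewrite eb.
  by rewrite bb -eb inE eH eZ.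
have bm := seg_lt sg bb.
by move: exy; rewrite eb => /set2_eq[[<- <-]|[<- <-]]; rewrite (farps b ab (ltnW bm)) (farps b.+1 (leqW ab) bm).
Qed.

End Cuts.

(** Telescoping with stride [d]: the sum is that of the first [d] values minus that of the [d]
    values from [N] on. *)
Lemma sum_antitone_gaps (a : nat -> nat) (d N : nat) :
  (forall i j, (i <= j)%N -> (a j <= a i)%N) ->
  (\sum_(i < N) (a i - a (i + d)) <= d * a 0)%N.
Proof.
move=> anti.
have eq : (\sum_(i < N) (a i - a (i + d)) + \sum_(t < d) a (N + t) = \sum_(t < d) a t)%N.
  elim: N => [|N IH]; first by rewrite big_ord0.
  rewrite big_ord_recr /= -IH -addnA; congr (_ + _)%N.
  have e : (\sum_(t < d) a (N.+1 + t) + a N = \sum_(t < d) a (N + t) + a (N + d))%N.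
    rewrite -(big_ord_recr d (fun t => a (N + t)%N)) big_ord_recl addn0 addnC; congr (_ + _)%N.
    by apply: eq_bigr => t _; rewrite addSnnS.
  apply/eqP; rewrite -(eqn_add2r (a (N + d)%N)) -e addnAC subnK ?anti ?leq_addr //.
  by rewrite addnC.
apply: leq_trans (_ : \sum_(t < d) a t <= _)%N; first by rewrite -eq leq_addr.
apply: leq_trans (_ : \sum_(t < d) a 0 <= _)%N; first by apply: leq_sum => t _; apply: anti.
by rewrite sum_nat_const card_ord.
Qed.

(** * Representatives of the components of a growing family of graphs *)

Section Representatives.
Variables (n : nat) (g : nat -> rel 'I_n).
Hypotheses (g_sym : forall j, symmetric (g j))
  (g_mono : forall i j x y, (i <= j)%N -> g i x y -> g j x y).

(** Choosing the least vertex makes a representative of a coarse class also represent its finer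
    class, so [alive] decreases with the level. *)
Definition rep j x : 'I_n := [arg min_(y < x | connect (g j) x y) y].

Lemma rep_connect j x : connect (g j) x (rep j x).
Proof. by rewrite /rep; case: arg_minnP. Qed.

Lemma rep_min j x y : connect (g j) x y -> (rep j x <= y)%N.
Proof. by rewrite /rep; case: arg_minnP => // i _ H /H. Qed.

Lemma rep_eq j x y : connect (g j) x y -> rep j x = rep j y.
Proof.
move=> xy; have yx : connect (g j) y x by rewrite (sym_connect_sym (@g_sym j)).
apply/val_inj/eqP; rewrite eqn_leq !rep_min //.
  exact: connect_trans yx (rep_connect _ _).
exact: connect_trans xy (rep_connect _ _).
Qed.

Lemma rep_rep i j x : (i <= j)%N -> rep j (rep i x) = rep j x.
Proof.
move=> ij; symmetry; apply: rep_eq.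
by apply: connect_sub (rep_connect i x) => u v /(g_mono ij)/connect1.
Qed.

Definition alive j := [set x | rep j x == x].

Lemma alive_anti i j : (i <= j)%N -> alive j \subset alive i.
Proof.
move=> ij; apply/fintype.subsetP => x; rewrite !inE => /eqP xj.
apply/eqP/val_inj/eqP; rewrite eqn_leq rep_min //= -{1}xj rep_min //.
by apply: connect_sub (rep_connect i x) => u v /(g_mono ij)/connect1.
Qed.

(* A class of level i merged into a larger one at level j > i either loses its
   representative or absorbs a class that does. *)
Lemma card_merged i j (U : {set 'I_n}) : (i <= j)%N ->
  (forall u, u \in U -> exists u', [/\ u' != u, rep i u = u, rep i u' = u' & rep j u' = rep j u]) ->
  (#|U| <= 2 * (#|alive i| - #|alive j|))%N.
Proof.
move=> ij HU; rewrite -(finset.setIidPr (alive_anti ij)) -cardsD.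
set D := alive i :\: alive j.
have /subset_leq_card : U \subset D :|: rep j @: D.
  apply/fintype.subsetP => u /HU[u' [uu' ru ru' rr]]; rewrite inE.
  have [uj|uj] := boolP (u \in alive j); last by rewrite finset.in_setD uj inE ru eqxx.
  apply/orP; right; apply/imsetP; exists u'; last by rewrite rr; move: uj; rewrite inE => /eqP.
  rewrite finset.in_setD !inE ru' eqxx andbT rr; apply: contra uu' => /eqP <-.
  by move: uj; rewrite inE => /eqP ->.
move=> /leq_trans; apply; apply: leq_trans (leq_card_setU _ _) _.
by rewrite mul2n -addnn leq_add2l leq_imset_card.
Qed.

End Representatives.

(** * Dyadic weight classes of added edges *)

Section Scales.
Variables (R : realType) (n : nat) (w : {set 'I_n} -> R) (E : {set {set 'I_n}}).
Variables (k beta L : nat) (H0 Hf : {set {set 'I_n}}).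
Hypotheses (w0 : forall e, e \in E -> 0 < w e)
  (E2 : forall e, e \in E -> #|e| = 2%N)
  (H0E : H0 \subset E) (cHf : completes w E k beta H0 Hf)
  (bottleneck : forall x y, [set x; y] \in E -> connect (light w H0 (w [set x; y])) x y)
  (nL : (n < 2 ^ L)%N) (kL : (4 * L + 3 <= k)%N).

(* Added edges of weight in [2^i om, 2^(i+1) om) have few short cycles modulo the
   components of H0 at scale 2^i om / 2^L, where paths are negligibly short. *)
Lemma card_added_sparse : (#|Hf :\: H0| <= 4 * L.+1 * n)%N.
Proof.
set F := Hf :\: H0.
have HfE := completes_sub w0 cHf H0E.
have FE e : e \in F -> e \in E by rewrite inE => /andP[_ /(fintype.subsetP HfE)].
have [->|/set0Pn[e0 e0F]] := eqVneq F finset.set0; first by rewrite cards0.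
have [v0 _] : exists v0, v0 \in e0.
  by apply/card_gt0P; rewrite E2 ?FE.
have /choice[ends Hends] : forall e : {set 'I_n}, exists xy : 'I_n * 'I_n, e \in E -> e = [set xy.1; xy.2].
  move=> e; have [eE|] := boolP (e \in E); last by exists (v0, v0).
  have [x [y [_ exy]]] : exists x y, x != y /\ e = [set x; y] by apply/cards2P; rewrite E2.
  by exists (x, y).
have [om om0 omE] : exists2 om, 0 < om & forall e, e \in E -> om <= w e.
  have e0E := FE _ e0F.
  case: (Order.TotalTheory.arg_minP w e0E) => e1 e1E emin.
  by exists (w e1); [apply: w0|move=> e; apply: emin].
(* As n < 2^L, a simple path of edges of weight at most 2^i mu is no longer than 2^i om, the least
   weight in class [i]. *)
pose mu := om / 2 ^+ L.
have mu0 : 0 < mu by rewrite divr_gt0 // exprn_gt0.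
pose g j := light w H0 (2 ^+ j * mu).
have g_sym j : symmetric (g j) by move=> x y; rewrite /g /light /= finset.setUC.
have g_mono i j x y : (i <= j)%N -> g i x y -> g j x y.
  rewrite /g /light /= => ij /andP[-> /= /le_trans]; apply.
  by rewrite ler_pM2r // ler_eXn2l ?ltr1n.
pose sc e := trunc_log 2 (Num.truncn (w e / om)).
have scP e : e \in E -> 2 ^+ sc e * om <= w e < 2 ^+ (sc e).+1 * om.
  move=> eE; have we0 : 0 <= w e / om by rewrite divr_ge0 ?ltW ?w0.
  have /andP[t1 t2] := Num.Theory.truncn_itv we0.
  have t0 : (0 < Num.truncn (w e / om))%N.
    by rewrite Num.Theory.truncn_gt0 ler_pdivlMr // mul1r omE.
  have /andP[l1 l2] := trunc_log_bounds (isT : (1 < 2)%N) t0.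
  rewrite -ler_pdivlMr // -ltr_pdivrMr //; apply/andP; split.
    by apply: le_trans t1; rewrite -natrX ler_nat.
  by apply: lt_le_trans t2 _; rewrite -natrX ler_nat.
pose Fi (i : nat) := [set e in F | sc e == i].
pose a j := #|alive g j|.
have FiE i e : e \in Fi i -> [/\ e \in F, e \in E, 2 ^+ i * om <= w e & w e < 2 ^+ i.+1 * om].
  by rewrite inE => /andP[eF /eqP si]; have /andP[] := scP _ (FE _ eF); rewrite si; split=> //; apply: FE.
(* One factor 2 is the bound for graphs without short cycles, the other comes from [card_merged].
   The shift [L.+1] gives 2^(i+L+1) mu = 2^(i+1) om, above all weights of the class, so by
   [bottleneck] the ends of its edges are then merged. *)
have cardFi i : (#|Fi i| <= 4 * (a i - a (i + L.+1)))%N.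
  pose src e := rep g i (ends e).1; pose tgt e := rep g i (ends e).2.
  have cyc (Z : {set {set 'I_n}}) : Z \subset Fi i -> Z != finset.set0 -> (#|Z| <= (2 * L).+1)%N ->
    exists chi f, [/\ f \in Z, crosses src tgt chi f &
      forall e, e \in Z -> e != f -> ~~ crosses src tgt chi e].
    move=> /fintype.subsetP ZF Z0 Zc.
    have th0 : 0 <= 2 ^+ i * mu by rewrite mulr_ge0 // ltW.
    have M0 : 0 < 2 ^+ i * om by rewrite mulr_gt0 // exprn_gt0.
    have ZHf : Z \subset Hf.
      by apply/fintype.subsetP => e /ZF /FiE[]; rewrite inE => /andP[].
    have ZH0 : ~~ (Z \subset H0).
      have /set0Pn[e eZ] := Z0; apply/subsetPn; exists e => //.
      by have /ZF /FiE[] := eZ; rewrite inE => /andP[].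
    have [||chi [f [fZ cl cf ce]]] := single_crossing w0 cHf (fintype.subxx _) th0 ZHf ZH0 M0.
    - by move=> e /ZF /FiE[].
    (* With M = 2^i om, light edges cost at most M and [2 * L + 1] edges of weight below 2 M cost
       the rest: (4 L + 3) M <= k M in all. *)
    - have s1 : n%:R * (2 ^+ i * mu) <= 2 ^+ i * om.
        rewrite mulrCA ler_wpM2l // /mu mulrCA; apply: ler_piMr; first exact: ltW.
        by rewrite ler_pdivrMr ?exprn_gt0 // mul1r -natrX ler_nat ltnW.
      have s2 : \sum_(e in Z) w e <= (2 * L).+1%:R * (2 * (2 ^+ i * om)).
        apply: (@le_trans _ _ (\sum_(e in Z) (2 * (2 ^+ i * om)))).
          by apply: ler_sum => e /ZF /FiE[_ _ _ /ltW]; rewrite exprS mulrA.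
        rewrite sumr_const -[leLHS]mulr_natl ler_wpM2r ?ler_nat //.
        by rewrite mulr_ge0 // ltW.
      apply: le_trans (lerD s1 s2) _.
      have -> : 2 ^+ i * om + (2 * L).+1%:R * (2 * (2 ^+ i * om)) = (4 * L + 3)%:R * (2 ^+ i * om).
        rewrite -[(2 * L).+1]addn1 !natrD ?natrM; ring.
      by rewrite ler_wpM2r ?ler_nat // ltW.
    have crep x : chi (rep g i x) = chi x.
      have := rep_connect g i x => /connectP[p pp ->].
      by elim: p x pp => //= z p IH x /andP[xz pp]; rewrite IH // (cl _ _ xz).
    exists chi, f; split=> //.
      by rewrite /crosses !crep; apply: cf; apply: Hends; have /ZF /FiE[] := fZ.
    move=> e eZ ef; rewrite /crosses !crep negbK; apply/eqP; apply: (ce e) => //.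
    by apply: Hends; have /ZF /FiE[] := eZ.
  pose U := (src @: Fi i) :|: (tgt @: Fi i).
  have Fin : Fi i \subset inner src tgt (Fi i) U.
    apply/fintype.subsetP => e eF; rewrite inE eF /= !inE; apply/andP; split.
      by apply/orP; left; apply/imsetP; exists e.
    by apply/orP; right; apply/imsetP; exists e.
  have := card_inner_le cyc U; rewrite card_ord => /(_ nL) cU.
  apply: leq_trans (leq_trans (subset_leq_card Fin) cU) _.
  rewrite -[4%N]/(2 * 2)%N -mulnA leq_mul2l /=.
  apply: (card_merged g_mono (leq_addr _ _)).
  have st e : e \in Fi i -> src e != tgt e.
    move=> eF; have [|||chi [f [+ cf _]]] := cyc [set e].
    - by rewrite finset.sub1set.
    - by apply/set0Pn; exists e; rewrite inE.
    - by rewrite cards1.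
    by rewrite inE => /eqP fe; apply: contraTneq cf; rewrite fe /crosses => ->; rewrite eqxx.
  have rr x : rep g i (rep g i x) = rep g i x by rewrite rep_rep.
  have merge e : e \in Fi i -> rep g (i + L.+1) (src e) = rep g (i + L.+1) (tgt e).
    move=> /FiE[_ eE _ we]; rewrite !rep_rep ?leq_addr //; apply: rep_eq => //.
    have exy := Hends _ eE; have := bottleneck (x := (ends e).1) (y := (ends e).2).
    rewrite -exy => /(_ eE); apply: connect_sub => u v /andP[uH uw]; apply: connect1.
    rewrite /g /light /= uH /=; apply: le_trans uw (le_trans (ltW we) _).
    by rewrite /mu addnS -addSn exprD mulrACA -[leRHS]mulrA mulfV ?mulr1 // expf_neq0.
  move=> u; rewrite inE => /orP[] /imsetP[e eF ->].
    by exists (tgt e); rewrite eq_sym st ?rr ?merge.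
  by exists (src e); rewrite st ?rr ?merge.
pose N := (\max_(e in F) sc e)%N.+1.
have cardF : (#|F| <= \sum_(i < N) #|Fi i|)%N.
  have FN e : e \in F -> (sc e < N)%N by move=> eF; rewrite ltnS; have := @leq_bigmax_cond _ (mem F) sc e eF.
  rewrite -sum1_card (partition_big (fun e => inord (sc e) : 'I_N) xpredT) //=.
  apply: leq_sum => i _; rewrite -sum1_card [leqRHS](eq_bigl (fun e => (e \in F) && (sc e == i))).
    rewrite [leqRHS](eq_bigl (fun e => (e \in F) && (inord (sc e) == i))) // => e.
    case: (boolP (e \in F)) => //= /FN lt.
    by rewrite -val_eqE /= inordK.
  by move=> e; rewrite inE.
apply: leq_trans cardF _.
apply: (@leq_trans (\sum_(i < N) 4 * (a i - a (i + L.+1)))); first by apply: leq_sum.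
rewrite -big_distrr /= -mulnA leq_mul2l /=.
apply: leq_trans (sum_antitone_gaps _ _ _) _.
  by move=> i j ij; apply: subset_leq_card; apply: alive_anti.
by rewrite leq_mul2l -[leqRHS](card_ord n) max_card orbT.
Qed.

End Scales.

(** * Counting added edges for small k *)

Lemma dist_sym (R : realType) n (w : {set 'I_n} -> R) F x y : dist w F x y = dist w F y x.
Proof.
have H u v : (dist w F u v <= dist w F v u)%E.
  apply: le_ereal_inf_tmp => _ [p /= wp <-]; have [q [wq <-]] := walk_rev w wp.
  exact: leD_walk.
by apply/eqP; rewrite eq_le !H.
Qed.

Lemma Wmax_ge (R : realType) n (w : {set 'I_n} -> R) (E : {set {set 'I_n}}) e :
  e \in E -> w e <= Wmax w E.
Proof. by move=> eE; rewrite /Wmax (bigD1 e) //= le_max lexx. Qed.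

Lemma half_bounds k : (2 <= k)%N ->
  [/\ (k./2 <= k.-1)%N, (2 * k./2 <= k)%N & (k.-1 - k./2 <= k./2)%N].
Proof. by have := odd_double_half k; case: (odd k) => /= ? ?; split; lia. Qed.

(** * Pairs of centers charged by a completion step *)

Section Charging.
Variables (R : realType) (n k : nat) (w : {set 'I_n} -> R) (E H0 : {set {set 'I_n}}).
Variables (lvl : 'I_n -> nat) (cen : nat -> 'I_n -> 'I_n).
Hypotheses (k2 : (2 <= k)%N) (w0 : forall e, e \in E -> 0 < w e)
  (H0E : H0 \subset E)
  (stretch : forall x y, [set x; y] \in E -> leD w H0 x y ((2 * k).-1%:R * w [set x; y]))
  (cenP : forall x y i, [set x; y] \in E -> ~~ leD w H0 x y (k%:R * w [set x; y]) ->
     (2 * i <= k)%N -> (i <= lvl (cen i x))%N /\ leD w H0 x (cen i x) (i%:R * w [set x; y])).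
Implicit Types (H : {set {set 'I_n}}) (x y c u v z : 'I_n).

Let W := Wmax w E.
Let delta : R := (k%:R - 1) * W / 2.
Let N := (4 * k + 6)%N.

Definition grid c c' (j : nat) : R :=
  k%:R * fine (dist w E c c') - (k%:R + 1) * (k%:R - 1) * W + j%:R * delta.

Definition charged H H' c c' j := leD w H' c c' (grid c c' j) && ~~ leD w H c c' (grid c c' j).

Lemma charged_sym H H' c c' j : charged H H' c c' j -> charged H H' c' c j.
Proof. by rewrite /charged /grid /leD !(dist_sym w _ c c'). Qed.

Let k1 : 1 <= (k%:R - 1 : R).
Proof. have : (2%:R <= k%:R :> R) by rewrite ler_nat. by lra. Qed.

(* The distance between the centers c, c' lies within (k+1)(k-1)W of k dist_E(c, c')
   whenever the pair is used, and drops by delta: it leaves one of O(k) thresholds. *)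
Lemma drop_charged H H' c c' u z (d r1 r2 V : R) :
  0 < W -> H0 \subset H -> H \subset E ->
  leD w H0 u c r1 -> leD w H0 z c' r2 -> 0 <= r1 -> 0 <= r2 ->
  r1 + r2 <= (k%:R - 1) * W ->
  (forall r, leD w E u z r = (d <= r)) ->
  ~~ leD w H u z (k%:R * d) ->
  leD w H' c c' V -> ~~ leD w H c c' (V + delta) -> V <= (k%:R - 1) * W + k%:R * d ->
  exists j : 'I_N, charged H H' c c' j.
Proof.
move=> W0 H0H HE luc lzc r10 r20 rr duz nuz lV nV Vd.
have kW : 0 < (k%:R - 1) * W by rewrite mulr_gt0 // (lt_le_trans _ k1).
have d0 : 0 < delta by rewrite divr_gt0.
set D := fine (dist w E c c').
have wE e : e \in E -> 0 <= w e by move=> /w0/ltW.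
have cuE := leD_sym (leD_sub H0E luc); have czE := leD_sub H0E lzc.
have uz : leD w E u z d by rewrite duz.
have cc := leD_trans (leD_trans cuE uz) czE.
have ccE := leD_fine wE cc; rewrite -/D in ccE.
have D1 : D <= r1 + d + r2 by rewrite -ccE.
have D2 : d <= r1 + D + r2.
  rewrite -duz; apply: leD_trans (leD_sym czE); apply: leD_trans (leD_sym cuE) _.
  by rewrite ccE.
have k0 : 0 <= k%:R :> R by [].
have kD1 : k%:R * D <= k%:R * (d + (k%:R - 1) * W) by rewrite ler_wpM2l //; lra.
have kD2 : k%:R * d <= k%:R * (D + (k%:R - 1) * W) by rewrite ler_wpM2l //; lra.
have base : grid c c' 0 = k%:R * D - (k%:R + 1) * (k%:R - 1) * W by rewrite /grid mul0r addr0.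
(* Below the lowest threshold, that threshold is newly reached: had [H] reached it, the route
   through [c] and [c'] would bring [u] and [z] within k d. *)
have [Vb|bV] := lerP V (grid c c' 0).
  have N0 : (0 < N)%N by rewrite /N addn_gt0 orbT.
  exists (Ordinal N0); rewrite /charged (leD_le Vb lV) /=; apply: contra nuz => lb.
  have lb' := leD_trans (leD_trans (leD_sub H0H luc) lb) (leD_sym (leD_sub H0H lzc)).
  by apply: leD_le lb'; rewrite base; lra.
pose q := (V - grid c c' 0) / delta.
have q0 : 0 <= q by rewrite divr_ge0 // ?subr_ge0 ltW.
have /andP[t1 t2] := Num.Theory.truncn_itv q0; set t := Num.truncn q in t1 t2.
have gridE j : grid c c' j = grid c c' 0 + j%:R * delta by rewrite base /grid.
rewrite /q ler_pdivlMr // in t1; rewrite /q ltr_pdivrMr // in t2.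
(* V - grid 0 is at most (2k+2)(k-1)W, which is (4k+4) delta; hence t <= 4k+4. Threshold [t.+1] is
   the one between V and V + delta. *)
have tN : (t.+1 < N)%N.
  suff : t%:R * delta < (4 * k + 5)%:R * delta.
    by rewrite ltr_pM2r // ltr_nat -ltnS -addnS.
  apply: le_lt_trans t1 _; rewrite base natrD natrM /delta.
  by lra.
exists (Ordinal tN); rewrite /charged /= gridE; apply/andP; split.
  by apply: leD_le lV; lra.
by apply: contra nV; apply: leD_le; rewrite -natr1 mulrDl mul1r; lra.
Qed.

(** Both levels are at most k/2, so missing edges have centers there; their sum k-1 makes the
    expected number of pairs of distinct centers at most n^2 p^(k-1) = n^(1+1/k). *)
Let lo := (k.-1 - k./2)%N.
Let hi := k./2.

Let lo_hi : (lo + hi)%N = k.-1.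
Proof. by rewrite subnK //; have [] := half_bounds k2. Qed.

Let hi_k : (2 * hi <= k)%N.
Proof. by have [] := half_bounds k2. Qed.

Let lo_le_hi : (lo <= hi)%N.
Proof. by have [] := half_bounds k2. Qed.

Let lo_k : (2 * lo <= k)%N.
Proof. by rewrite (leq_trans _ hi_k) // leq_mul2l lo_le_hi. Qed.

(** Triples of two centers and a threshold already reached. The set only grows with [H], and each
    completion step pays for its edges with new triples. *)
Definition potential H : {set 'I_n * 'I_n * 'I_N} :=
  [set t : 'I_n * 'I_n * 'I_N | [&& (lo <= lvl t.1.1)%N, (hi <= lvl t.1.2)%N &
               leD w H t.1.1 t.1.2 (grid t.1.1 t.1.2 t.2)]].

Lemma charged_potential H H' c c' (q : 'I_N) : (lo <= lvl c)%N -> (hi <= lvl c')%N ->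
  charged H H' c c' q -> (c, c', q) \in potential H' :\: potential H.
Proof. by move=> lc lc' /andP[h' h]; rewrite !inE /= lc lc' h' (negbTE h). Qed.

Section Step.
Variables (H H' : {set {set 'I_n}}) (m : nat) (X : nat -> 'I_n) (ps : nat -> R) (bad : pred nat).
Hypotheses (H0H : H0 \subset H) (HE : H \subset E)
  (sg : segmented w E k k.-1 H H' m X ps bad).

Let len i := ps i.+1 - ps i.
Let cost i j : R := \sum_(i <= l < j) (if bad l then len l else k%:R * len l).

Lemma ps_le i j : (i <= j)%N -> (j <= m)%N -> ps i <= ps j.
Proof. by rewrite leq_eqVlt => /orP[/eqP ->//|ij] jm; apply/ltW/(seg_mono sg). Qed.

Lemma len_ge0 i : (i < m)%N -> 0 <= len i.
Proof. by move=> im; rewrite subr_ge0 ps_le. Qed.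

Lemma len_gt0 i : bad i -> 0 < len i.
Proof. by move=> bi; rewrite /len -(seg_w sg bi) w0 // (seg_edge sg). Qed.

Lemma len_W i : bad i -> len i <= W.
Proof. by move=> bi; rewrite /len -(seg_w sg bi) Wmax_ge // (seg_edge sg). Qed.

Lemma step_sub : H \subset H'.
Proof. by apply/fintype.subsetP => e eH; apply/(seg_add sg); left. Qed.

Lemma leD_cost i j : (i <= j)%N -> (j <= m)%N -> leD w H' (X i) (X j) (cost i j).
Proof.
elim: j => [|j IH]; first by rewrite leqn0 => /eqP -> _; rewrite /cost big_geq // leD_refl.
rewrite leq_eqVlt => /orP[/eqP <- _|ij jm]; first by rewrite /cost big_geq // leD_refl.
rewrite /cost big_nat_recr //=; apply: leD_trans (IH ij (ltnW jm)) _.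
case: ifPn => bj; last exact: leD_sub step_sub (seg_good sg jm bj).
rewrite /len -(seg_w sg bj); apply: leD_edge; apply/(seg_add sg); right.
by exists j.
Qed.

Lemma leD_good i j : (i <= j)%N -> (j <= m)%N ->
  (forall l, (i <= l)%N -> (l < j)%N -> ~~ bad l) -> leD w H (X i) (X j) (k%:R * (ps j - ps i)).
Proof.
elim: j => [|j IH]; first by rewrite leqn0 => /eqP -> _ _; rewrite subrr mulr0 leD_refl.
rewrite leq_eqVlt => /orP[/eqP <- _ _|ij jm nb]; first by rewrite subrr mulr0 leD_refl.
have -> : k%:R * (ps j.+1 - ps i) = k%:R * (ps j - ps i) + k%:R * (ps j.+1 - ps j) by ring.
apply: leD_trans (seg_good sg jm (nb _ ij (ltnSn j))).
by apply: IH (ltnW jm) _ => // l il lj; apply: nb => //; apply: ltnW.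
Qed.

Lemma costD i j l : (i <= j)%N -> (j <= l)%N -> cost i l = cost i j + cost j l.
Proof. by move=> ij jl; rewrite /cost (big_cat_nat ij jl). Qed.

Lemma cost1 i : bad i -> cost i i.+1 = len i.
Proof. by move=> bi; rewrite /cost big_nat1 bi. Qed.

Lemma cost_le i j : (i <= j)%N -> (j <= m)%N -> cost i j <= k%:R * (ps j - ps i).
Proof.
move=> ij jm; rewrite -(telescope_sumr ps ij) mulr_sumr /cost !big_nat.
apply: ler_sum => l /andP[_ lj]; case: ifP => // _.
rewrite -[leLHS]mul1r ler_wpM2r //; first by apply: len_ge0; apply: leq_trans lj jm.
by have := k1; lra.
Qed.

Lemma far_bad i j : bad i -> (i < j)%N -> (j <= m)%N ->
  ~~ leD w H (X i) (X j) (k%:R * (ps j - ps i)).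
Proof.
move=> bi; rewrite leq_eqVlt => /orP[/eqP <- _|ij jm]; first exact: (seg_bad sg bi).
exact: (seg_min sg).
Qed.

Lemma far_bad_end i j : bad j -> (i <= j)%N ->
  ~~ leD w H (X i) (X j.+1) (k%:R * (ps j.+1 - ps i)).
Proof.
move=> bj; rewrite leq_eqVlt => /orP[/eqP ->|ij]; first exact: (seg_bad sg bj).
exact: (seg_min sg _ (seg_lt sg bj)).
Qed.

Lemma cen_bad i r (e : bool) : bad i -> (2 * r <= k)%N ->
  (r <= lvl (cen r (X (i + e))))%N /\ leD w H0 (X (i + e)) (cen r (X (i + e))) (r%:R * len i).
Proof.
move=> bi rk; have far : ~~ leD w H0 (X i) (X i.+1) (k%:R * len i).
  by apply: contra (seg_bad sg bi); apply: leD_sub.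
have eE := seg_edge sg bi; rewrite /len -(seg_w sg bi) in far *.
case: e; rewrite ?addn0 ?addn1; last exact: cenP.
rewrite finset.setUC in eE far *; apply: cenP => //.
by apply: contra far => /leD_sym.
Qed.

(** A common center brings the right ends within r (len i + len l) in [H], at most k/2 times that
    sum. If [p] were at least as long as [i], the sum would be at most twice their distance along
    the path, against [far_bad_end]. *)
Lemma same_center_end r i l p : (2 * r <= k)%N -> bad i -> bad p -> bad l ->
  (i < p)%N -> (p <= l)%N -> cen r (X i.+1) = cen r (X l.+1) -> len p < len i.
Proof.
move=> rk bi bp bl ip pl ec.
have [_] := cen_bad true bi rk; have [_] := cen_bad true bl rk; rewrite !addn1 -ec => l1 l2.
have le := leD_trans (leD_sub H0H l2) (leD_sym (leD_sub H0H l1)).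
have := far_bad_end bl (leq_trans ip pl); apply: contraNlt => lip.
apply: leD_le le.
have lm := seg_lt sg bl; have pm := seg_lt sg bp.
have h1 : len l <= ps l.+1 - ps i.+1 by rewrite lerD2l lerN2; apply: ps_le (leq_trans ip pl) (ltnW lm).
have h2 : (len p < len i) || (len i + len l <= 2 * (ps l.+1 - ps i.+1)).
  rewrite orbC; move: pl; rewrite leq_eqVlt => /orP[/eqP epl|pl].
    by rewrite -epl in h1 *; apply/orP; left; lra.
  have : len p + len l <= ps l.+1 - ps i.+1.
    have := ps_le ip (ltnW pm); have := ps_le pl (ltnW lm); rewrite /len; lra.
  have := len_gt0 bl => l0 lpl; apply/orP; left; lra.
move: h2; rewrite ltNge lip /= => h2.
have rk2 : 2 * r%:R <= k%:R :> R by rewrite -natrM ler_nat.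
have s0 : 0 <= len i + len l by rewrite addr_ge0 // ltW // len_gt0.
have := ler_wpM2r s0 rk2.
have k0 : 0 <= k%:R :> R by [].
have := ler_wpM2l k0 h2.
by lra.
Qed.

Lemma same_center_start r i l p : (2 * r <= k)%N -> bad i -> bad p -> bad l ->
  (i <= p)%N -> (p < l)%N -> cen r (X i) = cen r (X l) -> len p < len l.
Proof.
move=> rk bi bp bl ip pl ec.
have [_] := cen_bad false bi rk; have [_] := cen_bad false bl rk; rewrite !addn0 -ec => l1 l2.
have le := leD_trans (leD_sub H0H l2) (leD_sym (leD_sub H0H l1)).
have lm := seg_lt sg bl; have pm := seg_lt sg bp.
have il := leq_ltn_trans ip pl.
have := far_bad bi il (ltnW lm); apply: contraNlt => lip.
apply: leD_le le.
have h1 : len i <= ps l - ps i by rewrite lerD2r; apply: ps_le il (ltnW lm).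
have h2 : len i + len l <= 2 * (ps l - ps i).
  move: ip; rewrite leq_eqVlt => /orP[/eqP epl|ip].
    by rewrite epl in h1 *; lra.
  have : len i + len p <= ps l - ps i.
    have := ps_le ip (ltnW pm); have := ps_le pl (ltnW lm); rewrite /len; lra.
  have := len_gt0 bi => i0 lpl; lra.
have rk2 : 2 * r%:R <= k%:R :> R by rewrite -natrM ler_nat.
have s0 : 0 <= len i + len l by rewrite addr_ge0 // ltW // len_gt0.
have := ler_wpM2r s0 rk2.
have k0 : 0 <= k%:R :> R by [].
have := ler_wpM2l k0 h2.
by lra.
Qed.

(* Along J, equal centers at right ends force a descent of the edge weights, equal
   centers at left ends an ascent; hence right or left ends meet many centers. *)
Lemma size_le_centers (J : seq nat) r (P : {set 'I_n}) : (2 * r <= k)%N ->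
  sorted ltn J -> all bad J ->
  (forall j, j \in J -> cen r (X j) \in P /\ cen r (X j.+1) \in P) ->
  (size J <= 2 * #|P|)%N.
Proof.
move=> rk sJ /all_nthP bJ HP.
case sizeJ : (size J) => [//|s].
pose t i := nth 0%N J i.
have tJ (i : 'I_s.+1) : t i \in J by rewrite mem_nth // sizeJ.
have tb i : (i < s.+1)%N -> bad (t i) by move=> ?; apply: bJ; rewrite sizeJ.
have tlt i j : (i < j)%N -> (j < s.+1)%N -> (t i < t j)%N.
  by move=> ij js; apply: (sorted_ltn_nth ltn_trans) => //; rewrite inE sizeJ // (ltn_trans ij).
have tle i j : (i <= j)%N -> (j < s.+1)%N -> (t i <= t j)%N.
  by rewrite leq_eqVlt => /orP[/eqP ->//|ij js]; apply/ltnW/tlt.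
pose desc (i : 'I_s.+1) := (i.+1 < s.+1)%N && (len (t i.+1) < len (t i)).
(* [A] collects the positions without a descent after them, where centers of right ends are
   distinct; [B] the first position and those just after a descent, where centers of left ends are
   distinct. *)
pose A := [set i | ~~ desc i].
pose B := [set i : 'I_s.+1 | (0 < i)%N ==> desc (inord i.-1)].
have inj_end (i j : 'I_s.+1) : (i < j)%N -> i \in A -> cen r (X (t i).+1) <> cen r (X (t j).+1).
  move=> ij; rewrite inE /desc => iA ec; have is1 : (i.+1 < s.+1)%N by apply: leq_ltn_trans ij _.
  move: iA; rewrite is1 /= => /negP; apply.
  apply: (same_center_end rk _ _ _ _ _ ec); rewrite ?tb //; first exact: tlt.
  exact: tle.
have inj_start (i j : 'I_s.+1) : (i < j)%N -> j \in B -> cen r (X (t i)) <> cen r (X (t j)).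
  move=> ij; have j0 : (0 < j)%N by apply: leq_ltn_trans ij.
  have j1s : (j.-1 < s.+1)%N by apply: leq_ltn_trans (leq_pred _) (ltn_ord j).
  rewrite inE j0 /= /desc inordK // prednK // => /andP[_ lt] ec.
  suff : len (t j.-1) < len (t j) by rewrite ltNge (ltW lt).
  apply: (same_center_start rk _ _ _ _ _ ec); rewrite ?tb //.
    by apply: tle => //; rewrite -ltnS prednK.
  by apply: tlt => //; rewrite prednK.
have cardA : (#|A| <= #|P|)%N.
  rewrite -(card_in_imset (f := fun i : 'I_s.+1 => cen r (X (t i).+1))).
    by apply: subset_leq_card; apply/fintype.subsetP => c /imsetP[i _ ->]; apply: (HP _ (tJ i)).2.
  move=> i j iA jA ec; apply/val_inj/eqP; have [ij|ji|//] := ltngtP i j.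
    by have := inj_end _ _ ij iA ec.
  by have := inj_end _ _ ji jA (esym ec).
have cardB : (#|B| <= #|P|)%N.
  rewrite -(card_in_imset (f := fun i : 'I_s.+1 => cen r (X (t i)))).
    by apply: subset_leq_card; apply/fintype.subsetP => c /imsetP[i _ ->]; apply: (HP _ (tJ i)).1.
  move=> i j iB jB ec; apply/val_inj/eqP; have [ij|ji|//] := ltngtP i j.
    by have := inj_start _ _ ij jB ec.
  by have := inj_start _ _ ji iB (esym ec).
(* The successor map sends positions outside [A] injectively into [B]. *)
have cardAB : (#|~: A| <= #|B|)%N.
  have lts (i : 'I_s.+1) : i \in ~: A -> (i.+1 < s.+1)%N by rewrite !inE negbK => /andP[].
  rewrite -(card_in_imset (f := fun i : 'I_s.+1 => inord i.+1 : 'I_s.+1)).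
    apply: subset_leq_card; apply/fintype.subsetP => _ /imsetP[i iA ->].
    have is1 := lts _ iA; rewrite inE inordK //= inord_val.
    by move: iA; rewrite !inE negbK.
  move=> i j /lts is1 /lts js1 /(congr1 val) /=; rewrite !inordK // => -[].
  exact: val_inj.
have : (#|A| + #|~: A| = s.+1)%N by rewrite cardsC card_ord.
move=> <-; rewrite mul2n -addnn; apply: leq_add cardA (leq_trans cardAB cardB).
Qed.

Section Ends.
Variables (al om : nat).
Hypotheses (bal : bad al) (bom : bad om)
  (first_bad : forall l, bad l -> (al <= l)%N) (last_bad : forall l, bad l -> (l <= om)%N).

Let km : k.-1%:R = k%:R - 1 :> R.
Proof. by rewrite -subn1 natrB // (leq_trans _ k2). Qed.

Let alm := seg_lt sg bal.
Let omm := seg_lt sg bom.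

(** Outside the first and last missing edges every segment has stretch at most k, so the violation
    is passed on to the part between. *)
Lemma far_ends : ~~ leD w H (X al) (X om.+1) (k%:R * (ps om.+1 - ps al) + (k%:R - 1) * W).
Proof.
apply: contra (seg_viol sg) => le.
have le1 : leD w H (X 0%N) (X al) (k%:R * (ps al - ps 0%N)).
  by apply: leD_good (ltnW alm) _ => // l _ la; apply: contraL la => /first_bad; rewrite leqNgt.
have le2 : leD w H (X om.+1) (X m) (k%:R * (ps m - ps om.+1)).
  by apply: leD_good => // l ol _; apply: contraL ol => /last_bad; rewrite leqNgt.
by apply: leD_le (leD_trans (leD_trans le1 le) le2); rewrite km -/W; lra.
Qed.

(** A single missing edge would have stretch 2k-1 in [H0], within the allowance k len + (k-1) W. *)
Lemma ends_lt : (al < om)%N.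
Proof.
have := last_bad bal; rewrite leq_eqVlt => /orP[/eqP e|//].
have := far_ends; rewrite -e => /negP[]; have := leD_sub H0H (stretch (seg_edge sg bal)).
apply: leD_le; rewrite (seg_w sg bal) -/(len al).
have -> : (2 * k).-1%:R = k%:R + (k%:R - 1) :> R.
  rewrite -km -natrD; congr (_%:R); case: (k) k2 => // k' _.
  by rewrite mul2n -addnn !addSn /= addnS.
rewrite mulrDl lerD2l ler_wpM2l ?len_W //.
by have := k1; lra.
Qed.

Let W0 : 0 < W.
Proof. exact: lt_le_trans (len_gt0 bal) (len_W bal). Qed.

Section Levels.
Variables (r r' : nat).
Hypotheses (rr : (r + r')%N = k.-1) (rk : (2 * r <= k)%N) (rk' : (2 * r' <= k)%N).

Let rrR : k%:R - 1 = r%:R + r'%:R :> R.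
Proof. by rewrite -natrD rr km. Qed.

Let radii i j : bad i -> bad j -> r%:R * len i + r'%:R * len j <= (k%:R - 1) * W.
Proof. by move=> bi bj; rewrite rrR mulrDl lerD // ler_wpM2l // len_W. Qed.

Let radius_ge0 q i : bad i -> 0 <= q%:R * len i :> R.
Proof. by move=> bi; rewrite mulr_ge0 // ltW // len_gt0. Qed.

Let delta0 : 0 <= delta.
Proof. by rewrite divr_ge0 // mulr_ge0 //; [exact: le_trans k1|exact: ltW]. Qed.

Let delta2 : 2 * delta = (k%:R - 1) * W.
Proof. by rewrite /delta; lra. Qed.

(** Were the centers already within V + delta, the detour through them would exceed k times the path
    length by at most (r - r')(len al - len om) + delta, as k-1 = r + r'. The sign condition then
    contradicts [far_ends]. *)
Lemma ends_charged : (r%:R - r'%:R) * (len al - len om) <= 0 ->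
  exists q : 'I_N, charged H H' (cen r (X al)) (cen r' (X om.+1)) q.
Proof.
move=> cond; have aom := ends_lt.
have [_ c1] := cen_bad false bal rk; have [_ c2] := cen_bad true bom rk'.
rewrite addn0 in c1; rewrite addn1 in c2.
have c1H := leD_sub H0H c1; have c2H := leD_sub H0H c2.
have cst := leD_cost (leqW (ltnW aom)) omm.
have cE : cost al om.+1 <= k%:R * (ps om.+1 - ps al) - (k%:R - 1) * (len al + len om).
  rewrite (costD (leqnSn al) (leqW aom)) (costD aom (leqnSn om)) !cost1 //.
  by have := cost_le aom (ltnW omm); rewrite /len; lra.
apply: (drop_charged (V := r%:R * len al + cost al om.+1 + r'%:R * len om)
  W0 H0H HE c1 c2 (radius_ge0 r bal) (radius_ge0 r' bom) (radii bal bom) _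
  (far_bad bal (leqW aom) omm)) => //.
- by move=> x; rewrite (seg_dist sg) // leqW // ltnW.
- by apply: leD_trans (leD_sub step_sub c2H); apply: leD_trans cst; apply: leD_sym (leD_sub step_sub c1H).
- apply/negP => le; have := far_ends; apply/negP/negPn.
  apply: leD_le (leD_trans (leD_trans c1H le) (leD_sym c2H)).
  by have d2 := delta2; have d0 := delta0; rewrite rrR in cE d2 *; lra.
have := cost_le (leqW (ltnW aom)) omm; have := radii bal bom; lra.
Qed.

(** If both pairs were within V + delta, joining the detours at the middle center would exceed k
    times the path length by at most (r - r')(len al + len om - len j) + 2 delta. Since 2 delta =
    (k-1) W, this contradicts [far_ends]. The flag [e] selects an end of edge [j]. *)
Lemma middle_charged j (e : bool) : bad j -> (al < j)%N -> (j < om)%N ->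
  (r%:R - r'%:R) * (len al + len om - len j) <= 0 ->
  exists q : 'I_N, charged H H' (cen r (X al)) (cen r' (X (j + e))) q \/
                   charged H H' (cen r (X om.+1)) (cen r' (X (j + e))) q.
Proof.
move=> bj aj jo cond; have aom := ends_lt.
have [_ c1] := cen_bad false bal rk; have [_ c2] := cen_bad true bom rk.
have [_ cz] := cen_bad e bj rk'.
rewrite addn0 in c1; rewrite addn1 in c2.
have c1H := leD_sub H0H c1; have c2H := leD_sub H0H c2; have czH := leD_sub H0H cz.
set i := (j + e)%N in cz czH *.
have ai : (al < i)%N by rewrite ltn_addr.
have io : (i <= om)%N by rewrite /i; case: (e); rewrite ?addn0 ?addn1 // ltnW.
have im : (i <= m)%N by apply: leq_trans io (ltnW omm).
have cst1 := leD_cost (ltnW ai) im; have cst2 := leD_cost (leqW io) omm.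
have cE : cost al i + cost i om.+1 <=
    k%:R * (ps om.+1 - ps al) - (k%:R - 1) * (len al + len j + len om).
  rewrite -(costD (ltnW ai) (leqW io)) (costD (leqnSn al) (leqW aom)) (costD aom (leqnSn om)).
  rewrite (costD aj (ltnW jo)) (costD (leqnSn j) jo) !cost1 //.
  have := cost_le aj (ltnW (ltn_trans jo omm)); have := cost_le jo (ltnW omm).
  by rewrite /len; lra.
pose V1 := r%:R * len al + cost al i + r'%:R * len j.
pose V2 := r'%:R * len j + cost i om.+1 + r%:R * len om.
have : ~~ leD w H (cen r (X al)) (cen r' (X i)) (V1 + delta) \/
       ~~ leD w H (cen r' (X i)) (cen r (X om.+1)) (V2 + delta).
  apply/orP; rewrite -negb_and; apply/negP => /andP[le1 le2].
  have := far_ends; apply/negP/negPn.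
  apply: leD_le (leD_trans (leD_trans c1H (leD_trans le1 le2)) (leD_sym c2H)).
  by have d2 := delta2; rewrite /V1 /V2; rewrite rrR in cE d2 *; lra.
case=> far.
  have [q hq] : exists q : 'I_N, charged H H' (cen r (X al)) (cen r' (X i)) q.
    apply: (drop_charged (V := V1) W0 H0H HE c1 cz (radius_ge0 r bal)
      (radius_ge0 r' bj) (radii bal bj) _ (far_bad bal ai im)) => //.
    - by move=> x; rewrite (seg_dist sg) // ltnW.
    - by apply: leD_trans (leD_sub step_sub czH); apply: leD_trans cst1; apply: leD_sym (leD_sub step_sub c1H).
    by have := cost_le (ltnW ai) im; have := radii bal bj; rewrite /V1; lra.
  by exists q; left.
have [q hq] : exists q : 'I_N, charged H H' (cen r' (X i)) (cen r (X om.+1)) q.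
  apply: (drop_charged (V := V2) W0 H0H HE cz c2 (radius_ge0 r' bj)
    (radius_ge0 r bom) _ _ (far_bad_end bom io)) => //.
  - by rewrite addrC; apply: radii.
  - by move=> x; rewrite (seg_dist sg) // leqW.
  - by apply: leD_trans (leD_sub step_sub c2H); apply: leD_trans cst2; apply: leD_sym (leD_sub step_sub czH).
  by have := cost_le (leqW io) omm; have := radii bom bj; rewrite /V2; lra.
by exists q; right; apply: charged_sym.
Qed.

End Levels.

Let D := potential H' :\: potential H.

Let lvl_bad i r (e : bool) : bad i -> (2 * r <= k)%N -> (r <= lvl (cen r (X (i + e))))%N.
Proof. by move=> bi rk; have [] := cen_bad e bi rk. Qed.

Let lvl_al r : (2 * r <= k)%N -> (r <= lvl (cen r (X al)))%N.
Proof. by move=> rk; have := lvl_bad false bal rk; rewrite addn0. Qed.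

Let lvl_om r : (2 * r <= k)%N -> (r <= lvl (cen r (X om.+1)))%N.
Proof. by move=> rk; have := lvl_bad true bom rk; rewrite addn1. Qed.

Let hi_lo : (hi + lo)%N = k.-1. Proof. by rewrite addnC. Qed.

Let lohiR : lo%:R - hi%:R <= 0 :> R.
Proof. by rewrite subr_le0 ler_nat. Qed.

Let hiloR : 0 <= hi%:R - lo%:R :> R.
Proof. by rewrite subr_ge0 ler_nat. Qed.

Lemma card_drop_gt0 : (0 < #|D|)%N.
Proof.
apply/card_gt0P; have [le|lt] := lerP (len om) (len al).
  have [|q hq] := ends_charged lo_hi lo_k hi_k.
    by rewrite mulr_le0_ge0 // subr_ge0.
  by exists (cen lo (X al), cen hi (X om.+1), q); apply: charged_potential (lvl_al lo_k) (lvl_om hi_k) hq.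
have [|q hq] := ends_charged hi_lo hi_k lo_k.
  by rewrite mulr_ge0_le0 // subr_le0 ltW.
exists (cen lo (X om.+1), cen hi (X al), q).
exact: charged_potential (lvl_om lo_k) (lvl_al hi_k) (charged_sym hq).
Qed.

Let middle j := [&& bad j, (al < j)%N & (j < om)%N].
Let small j := len j <= len al + len om.

Let sorted_mid (p : pred nat) : sorted ltn [seq j <- iota 0 m | p j].
Proof. by apply: sorted_filter; [exact: ltn_trans|exact: iota_ltn_sorted]. Qed.

(** For short middle edges the sign condition holds with [lo] at the outer ends and [hi] in the
    middle. Their distinct [hi] centers appear in new triples, and [size_le_centers] costs the
    factor 2. *)
Lemma size_small : (size [seq j <- iota 0 m | middle j && small j] <= 2 * #|D|)%N.
Proof.
apply: (@leq_trans (2 * #|[set t.1.2 | t in D]|)); last by rewrite leq_mul2l leq_imset_card.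
apply: (size_le_centers hi_k (sorted_mid _)).
  by apply/allP => j; rewrite mem_filter => /andP[/andP[/and3P[]]].
move=> j; rewrite mem_filter => /andP[/andP[/and3P[bj aj jo] sj] _].
suff key (e : bool) : cen hi (X (j + e)) \in [set t.1.2 | t in D].
  by have := key false; have := key true; rewrite addn0 addn1.
have [|q [hq|hq]] := middle_charged lo_hi lo_k hi_k e bj aj jo.
- by rewrite mulr_le0_ge0 // subr_ge0.
- by apply/imsetP; exists (cen lo (X al), cen hi (X (j + e)), q) => //;
    apply: charged_potential (lvl_al lo_k) (lvl_bad _ bj hi_k) hq.
by apply/imsetP; exists (cen lo (X om.+1), cen hi (X (j + e)), q) => //;
  apply: charged_potential (lvl_om lo_k) (lvl_bad _ bj hi_k) hq.
Qed.

Lemma size_large : (size [seq j <- iota 0 m | middle j && ~~ small j] <= 2 * #|D|)%N.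
Proof.
apply: (@leq_trans (2 * #|[set t.1.1 | t in D]|)); last by rewrite leq_mul2l leq_imset_card.
apply: (size_le_centers lo_k (sorted_mid _)).
  by apply/allP => j; rewrite mem_filter => /andP[/andP[/and3P[]]].
move=> j; rewrite mem_filter => /andP[/andP[/and3P[bj aj jo]]].
rewrite /small -ltNge => sj _.
suff key (e : bool) : cen lo (X (j + e)) \in [set t.1.1 | t in D].
  by have := key false; have := key true; rewrite addn0 addn1.
have [|q [hq|hq]] := middle_charged hi_lo hi_k lo_k e bj aj jo.
- by rewrite mulr_ge0_le0 // subr_le0 ltW.
- by apply/imsetP; exists (cen lo (X (j + e)), cen hi (X al), q) => //;
    apply: charged_potential (lvl_bad _ bj lo_k) (lvl_al hi_k) (charged_sym hq).
by apply/imsetP; exists (cen lo (X (j + e)), cen hi (X om.+1), q) => //;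
  apply: charged_potential (lvl_bad _ bj lo_k) (lvl_om hi_k) (charged_sym hq).
Qed.

(** Short and long middle edges give 4 [#|D|]; the two extreme edges are absorbed because [D] is
    nonempty. *)
Lemma card_step_ends : (#|H' :\: H| <= 6 * #|D|)%N.
Proof.
have c1 : (#|H' :\: H| <= count bad (iota 0 m))%N.
  rewrite -size_filter -(size_map (fun a => [set X a; X a.+1])).
  apply: leq_trans (card_size _); apply: subset_leq_card; apply/fintype.subsetP => e.
  rewrite inE => /andP[eH /(seg_add sg)[|[a ba ->]]]; first by rewrite (negbTE eH).
  by apply: map_f; rewrite mem_filter ba mem_iota (seg_lt sg ba).
have c2 : (count bad (iota 0 m) <= count middle (iota 0 m) + 2)%N.
  have one j : (count (pred1 j) (iota 0 m) <= 1)%N.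
    by rewrite (count_uniq_mem _ (iota_uniq _ _)); case: (_ \in _).
  apply: (@leq_trans (count (predU middle (predU (pred1 al) (pred1 om))) (iota 0 m))).
    apply: sub_count => j bj /=; rewrite /middle bj /=.
    have := first_bad bj; rewrite leq_eqVlt => /orP[/eqP ->|->]; first by rewrite eqxx orbT.
    have := last_bad bj; rewrite leq_eqVlt => /orP[/eqP ->|->//].
    by rewrite eqxx !orbT.
  apply: leq_trans (_ : count middle (iota 0 m) + count (predU (pred1 al) (pred1 om)) (iota 0 m) <= _)%N.
    by rewrite -count_predUI leq_addr.
  rewrite leq_add2l; apply: leq_trans (leq_add (one al) (one om)).
  by rewrite -count_predUI leq_addr.
have c3 : (count middle (iota 0 m) <= 2 * #|D| + 2 * #|D|)%N.
  have := leq_add size_small size_large; rewrite !size_filter; apply: leq_trans.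
  rewrite -count_predUI; apply: leq_trans (leq_addr _ _); apply: sub_count => j /= ->.
  by rewrite orbN.
have := card_drop_gt0; move: c1 c2 c3; clear.
by lia.
Qed.

End Ends.

Lemma card_step : (#|H' :\: H| <= 6 * #|potential H' :\: potential H|)%N.
Proof.
have bm l : bad l -> (l <= m)%N by move=> /(seg_lt sg)/ltnW.
have ex : exists l, bad l.
  apply: contrapT => nex; have /negP := seg_viol sg; apply.
  have W0 : 0 <= W by apply: bigmax_ge_id.
  have le : leD w H (X 0%N) (X m) (k%:R * (ps m - ps 0%N)).
    by apply: leD_good => // l _ _; apply/negP => bl; apply: nex; exists l.
  by apply: leD_le le; rewrite lerDl mulr_ge0.
case: (ex_minnP ex) => al bal first_bad; case: (ex_maxnP ex bm) => om bom last_bad.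
exact: (card_step_ends bal bom first_bad last_bad).
Qed.

End Step.

Lemma card_added_potential H Hf : completes w E k k.-1 H Hf -> H0 \subset H -> H \subset E ->
  (#|Hf :\: H| + 6 * #|potential H| <= 6 * #|potential Hf|)%N.
Proof.
elim=> {H Hf} [H _ _ _|H H' Hf st _ IH H0H HE]; first by rewrite finset.setDv cards0.
have [m [X [ps [bad sg]]]] := cstepE w0 st.
have HH := step_sub sg.
have HE' : H' \subset E.
  by apply/fintype.subsetP => e /(seg_add sg)[/(fintype.subsetP HE)//|[a /(seg_edge sg) + ->]].
have := IH (fintype.subset_trans H0H HH) HE'; apply: leq_trans.
have cP : (#|potential H'| = #|potential H| + #|potential H' :\: potential H|)%N.
  have sub : potential H \subset potential H'.
    apply/fintype.subsetP => t; rewrite !inE => /and3P[-> -> /=].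
    exact: leD_sub.
  by rewrite -(cardsID (potential H) (potential H')) (finset.setIidPr sub).
have c1 : (#|Hf :\: H| <= #|Hf :\: H'| + #|H' :\: H|)%N.
  apply: leq_trans (leq_card_setU _ _); apply: subset_leq_card.
  by apply/fintype.subsetP => e; rewrite !inE => /andP[-> ->]; case: (e \in H').
rewrite cP mulnDr [(6 * _ + _)%N in leqRHS]addnC addnA leq_add2r.
by apply: leq_trans c1 _; rewrite leq_add2l; apply: card_step sg.
Qed.

Lemma card_added_dense Hf : completes w E k k.-1 H0 Hf ->
  (#|Hf :\: H0| <= 6 * (4 * k + 6) *
    (#|[set c | (lo <= lvl c)%N]| * #|[set c | (hi <= lvl c)%N]|))%N.
Proof.
move=> cH; have := card_added_potential cH (fintype.subxx _) H0E.
move=> /(leq_trans (leq_addr _ _)) /leq_trans; apply.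
rewrite -mulnA leq_mul2l /= mulnC -cardsX -[X in (_ * X)%N](card_ord N) -[#|'I_N|]cardsT -cardsX.
apply: subset_leq_card; apply/fintype.subsetP => -[[c c'] q].
by rewrite !inE /= => /and3P[-> ->].
Qed.

End Charging.

(** * Sampling probabilities *)

Section Sampling.
Variables (R : realType) (n k : nat).
Hypotheses (n0 : (0 < n)%N) (k2 : (2 <= k)%N).

Local Notation p := (bs_p R n k).

Let k0 : (0 < k)%N := ltnW k2.

Lemma bs_p_gt0 : 0 < p.
Proof. by rewrite powR_gt0 // ltr0n. Qed.

Lemma bs_p_le1 : p <= 1.
Proof. by rewrite -(powRr0 n%:R) ler_powR ?ler1n // oppr_le0 invr_ge0. Qed.

Definition level_prob (j : 'I_k) : R := p ^+ j * (if (j.+1 < k)%N then 1 - p else 1).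

Lemma level_prob_ge0 j : 0 <= level_prob j.
Proof.
rewrite mulr_ge0 ?exprn_ge0 ?(ltW bs_p_gt0) //.
by case: ifP => // _; rewrite subr_ge0 bs_p_le1.
Qed.

Lemma lvl_prob_ge0 (lvl : {ffun 'I_n -> 'I_k}) : 0 <= lvl_prob R lvl.
Proof. by apply: prodr_ge0 => v _; apply: level_prob_ge0. Qed.

(** The terms p^j - p^(j+1) telescope, and the top level, lacking the factor 1 - p, supplies the
    last power. *)
Lemma sum_level_prob r : (r < k)%N -> \sum_(j < k | (r <= j)%N) level_prob j = p ^+ r.
Proof.
move=> rk; pose F j : R := p ^+ j * (if (j.+1 < k)%N then 1 - p else 1).
have -> : \sum_(j < k | (r <= j)%N) level_prob j = \sum_(r <= j < k) F j.
  by rewrite big_geq_mkord.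
rewrite /F.
rewrite -[X in \sum_(_ <= _ < X) _](prednK k0) big_nat_recr /=; last by rewrite -ltnS prednK.
rewrite prednK // ltnn mulr1 (eq_big_nat _ _ (F2 := fun j => - (p ^+ j.+1 - p ^+ j))).
  by rewrite sumrN telescope_sumr ?opprB ?subrK // -ltnS prednK.
move=> j /andP[_ jk]; have -> : (j.+1 < k)%N by rewrite -ltnS prednK in jk.
by rewrite exprS; ring.
Qed.

Lemma sum_lvl_prob_prod (g : 'I_n -> 'I_k -> R) :
  \sum_(lvl : {ffun 'I_n -> 'I_k}) lvl_prob R lvl * \prod_v g v (lvl v) =
  \prod_v \sum_j level_prob j * g v j.
Proof.
rewrite bigA_distr_bigA; apply: eq_bigr => lvl _.
by rewrite /lvl_prob -big_split.
Qed.

Lemma sum_lvl_prob : \sum_(lvl : {ffun 'I_n -> 'I_k}) lvl_prob R lvl = 1.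
Proof.
transitivity (\sum_(lvl : {ffun 'I_n -> 'I_k}) lvl_prob R lvl * \prod_(v < n) 1).
  by apply: eq_bigr => lvl _; rewrite big1 ?mulr1.
rewrite (sum_lvl_prob_prod (fun _ _ => 1)) big1 // => v _.
under eq_bigr do rewrite mulr1.
by have := sum_level_prob k0; rewrite expr0.
Qed.

Lemma prob_two_levels (a b : nat) (c c' : 'I_n) : (a < k)%N -> (b < k)%N ->
  \sum_(lvl : {ffun 'I_n -> 'I_k}) lvl_prob R lvl * ((a <= lvl c)%N && (b <= lvl c')%N)%:R
  <= if c == c' then 1 else p ^+ (a + b).
Proof.
move=> ak bk.
case: eqP => [_|/eqP cc].
  rewrite -[leRHS]sum_lvl_prob; apply: ler_sum => lvl _.
  apply: ler_piMr; first exact: lvl_prob_ge0.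
  by case: (_ && _).
(* The indicator becomes a product over all vertices, so the expectation factors by independence. *)
pose g (v : 'I_n) (j : 'I_k) : R :=
  (((v == c) ==> (a <= j)%N) && ((v == c') ==> (b <= j)%N))%:R.
rewrite (eq_bigr (fun lvl => lvl_prob R lvl * \prod_v g v (lvl v))) => [|lvl _]; last first.
  congr (_ * _); rewrite (bigD1 c) //= (bigD1 c') /= ?(eq_sym c') //.
  rewrite /g !eqxx (negbTE cc) eq_sym (negbTE cc) /= andbT big1 => [|v /andP[vc vc']].
    by rewrite mulr1 -natrM mulnb.
  by rewrite (negbTE vc) (negbTE vc').
have sumE r : (r < k)%N -> \sum_j level_prob j * (r <= j)%N%:R = p ^+ r.
  move=> rk; rewrite -sum_level_prob // [RHS]big_mkcond /=; apply: eq_bigr => j _.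
  by case: ifP; rewrite ?mulr1 ?mulr0.
rewrite sum_lvl_prob_prod (bigD1 c) //= (bigD1 c') /=; last by rewrite eq_sym.
rewrite [X in _ * (_ * X)]big1 => [|v /andP[vc vc']]; last first.
  rewrite /g (negbTE vc) (negbTE vc') /=; under eq_bigr do rewrite mulr1.
  by have := sum_level_prob k0; rewrite expr0.
rewrite /g !eqxx (negbTE cc) eq_sym (negbTE cc) /= mulr1 exprD.
by under eq_bigr do rewrite andbT; rewrite !sumE.
Qed.

(** The diagonal costs n, and the n^2 pairs cost p^(k-1) each; both totals are at most n^(1+1/k). *)
Lemma expected_level_pairs a b : (a + b)%N = k.-1 ->
  \sum_(lvl : {ffun 'I_n -> 'I_k}) lvl_prob R lvl *
    (#|[set c | (a <= lvl c)%N]| * #|[set c | (b <= lvl c)%N]|)%:R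
  <= 2 * n%:R `^ (1 + k%:R^-1).
Proof.
move=> ab.
have ak : (a < k)%N by rewrite -(prednK k0) ltnS -ab leq_addr.
have bk : (b < k)%N by rewrite -(prednK k0) ltnS -ab leq_addl.
have cardE (lvl : {ffun 'I_n -> 'I_k}) :
    (#|[set c | (a <= lvl c)%N]| * #|[set c | (b <= lvl c)%N]|)%:R =
    \sum_c \sum_c' ((a <= lvl c)%N && (b <= lvl c')%N)%:R :> R.
  rewrite -!sum1dep_card natrM !natr_sum big_distrl [LHS]big_mkcond /=.
  apply: eq_bigr => c _; case: (a <= lvl c)%N => /=; last by rewrite big1.
  by rewrite mul1r [LHS]big_mkcond; apply: eq_bigr => c' _; case: ifP.
under eq_bigr => lvl _ do rewrite cardE big_distrr /=.
rewrite exchange_big /=.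
under eq_bigr => c _ do under eq_bigr => lvl _ do rewrite big_distrr /=.
under eq_bigr => c _ do rewrite exchange_big /=.
have n1 : 1 <= n%:R :> R by rewrite ler1n.
have nz : n%:R != 0 :> R by rewrite pnatr_eq0 -lt0n.
have kz : k%:R != 0 :> R by rewrite pnatr_eq0 -lt0n.
apply: (@le_trans _ _ (\sum_(c < n) \sum_(c' < n) ((c == c')%:R + p ^+ k.-1))).
  apply: ler_sum => c _; apply: ler_sum => c' _.
  apply: le_trans (prob_two_levels c c' ak bk) _; rewrite ab.
  by case: eqP => _; rewrite ?add0r // lerDl exprn_ge0 // ltW // bs_p_gt0.
have rowE (c : 'I_n) : \sum_(c' < n) ((c == c')%:R + p ^+ k.-1) = 1 + p ^+ k.-1 *+ n.
  rewrite big_split /= sumr_const card_ord (bigD1 c) //= eqxx big1 ?addr0 // => i.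
  by rewrite eq_sym => /negbTE ->.
under eq_bigr => c _ do rewrite rowE.
rewrite sumr_const card_ord mulrnDl mulr2n mulrDl mul1r lerD //.
  by rewrite -{1}[n%:R]powRr1 // ler_powR // lerDl invr_ge0.
rewrite -mulrnA -[leLHS]mulr_natr natrM -{1 2}[n%:R]powRr1 // -powRD; last by rewrite nz implybT.
rewrite -powR_mulrn ?powR_ge0 // -powRrM -powRD; last by rewrite nz implybT.
rewrite (_ : k.-1%:R = k%:R - 1) -?subn1 ?natrB //.
by rewrite mulrBr mulNr mulVf // mulr1 le_eqVlt; apply/orP; left; apply/eqP; congr (_ `^ _); ring.
Qed.

End Sampling.

(** * Conclusion *)

Section Deterministic.
Variables (R : realType) (n k : nat) (E : {set {set 'I_n}}) (w : {set 'I_n} -> R)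
  (tb : {set 'I_n} -> nat) (lvl : {ffun 'I_n -> 'I_k}).
Hypotheses (k2 : (2 <= k)%N) (E2 : forall e, e \in E -> #|e| = 2%N)
  (w0 : forall e, e \in E -> 0 < w e).

Local Notation H0 := (bs_spanner E w tb lvl).

Lemma bs_bottleneck x y : [set x; y] \in E -> connect (light w H0 (w [set x; y])) x y.
Proof.
move=> /(bs_stretch w tb lvl E2)[p [/andP[pp /eqP e] _]]; subst y.
by apply/connectP; exists p => //; apply: sub_path pp => u v; rewrite /light /= inE.
Qed.

Lemma added_sparse L : (n < 2 ^ L)%N -> (4 * L + 3 <= k)%N ->
  (added E w tb lvl <= 4 * L.+1 * n)%N.
Proof.
move=> nL kL; apply/bigmax_leqP => Hf /asboolP cH.
exact: card_added_sparse w0 E2 (bs_spanner_sub w tb lvl E2) cH bs_bottleneck nL kL.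
Qed.

Lemma added_dense : (added E w tb lvl <= 6 * (4 * k + 6) *
  (#|[set c | (k.-1 - k./2 <= lvl c)%N]| * #|[set c | (k./2 <= lvl c)%N]|))%N.
Proof.
apply/bigmax_leqP => Hf /asboolP cH.
have w0' e : e \in E -> 0 <= w e by move=> /w0/ltW.
apply: (card_added_dense (w := w) (lvl := fun v => lvl v) (cen := cluster_center E w tb lvl) k2 w0
  (bs_spanner_sub w tb lvl E2) _ _ cH).
  move=> x y xy; apply: hops_leD (bs_stretch w tb lvl E2 xy); exact: w0'.
by move=> x y i xE far ik; apply: bs_cluster_center.
Qed.

End Deterministic.

Lemma trunc_log_le_ln (R : realType) n : (0 < n)%N ->
  (trunc_log 2 n)%:R * ln 2 <= ln n%:R :> R.
Proof.
move=> n0; rewrite mulr_natl -lnXn // ler_ln ?posrE ?exprn_gt0 ?ltr0n //.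
by rewrite -natrX ler_nat; have /andP[] := trunc_log_bounds (isT : (1 < 2)%N) n0.
Qed.

Theorem theorem3p4 (R : realType) :
  exists (C : R) (c : nat),
  forall (k n : nat) (E : {set {set 'I_n}}) (w : {set 'I_n} -> R)
         (tb : {set 'I_n} -> nat),
    (2 <= k)%N ->
    (forall e, e \in E -> #|e| = 2%N) ->
    (forall e, e \in E -> 0 < w e) ->
    (forall u v : 'I_n, [set u; v] \in E -> dist w E u v = (w [set u; v])%:E) ->
    {in E &, injective tb} ->
    \sum_(lvl : {ffun 'I_n -> 'I_k}) lvl_prob R lvl * (added E w tb lvl)%:R
      <= C * (1 + ln (n%:R : R)) ^+ c * (n%:R `^ (1 + (k%:R)^-1)).
Proof.
have ln2 : 0 < ln (2 : R) by rewrite ln_gt0 // ltr1n.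
(* With L = t + 1, the common factor 12 (16 L + 14) of both cases is 192 t + 360, and t <= ln n / ln
   2. *)
pose K : R := 192 / ln 2 + 360.
have c0 : 0 <= 192 / ln 2 :> R := divr_ge0 (ler0n R 192) (ltW ln2).
have K0 : 0 <= K := addr_ge0 c0 (ler0n R 360).
exists K, 1%N => k n E w tb k2 E2 w0 _ _; rewrite expr1.
have k0 : 0 <= k%:R^-1 :> R by rewrite invr_ge0.
have [n0|n0] := posnP n.
  rewrite [leRHS](_ : _ = 0); last first.
    by rewrite [X in _ * (X `^ _)](_ : _ = 0) ?n0 // powR0 ?mulr0 // gt_eqF // ltr_pwDl.
  rewrite big1 // => lvl _; apply/eqP; rewrite mulf_eq0 pnatr_eq0 -leqn0; apply/orP; right.
  apply: leq_trans (added_dense tb lvl k2 E2 w0) _; rewrite leqn0 !muln_eq0; apply/orP; right.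
  by apply/orP; left; rewrite -leqn0 -n0 -[leqRHS]card_ord max_card.
set t := trunc_log 2 n; pose L := t.+1.
have nL : (n < 2 ^ L)%N by apply: trunc_log_ltn.
have n1 : 1 <= n%:R :> R by rewrite ler1n.
have tln : t%:R <= ln n%:R / ln 2 :> R by rewrite ler_pdivlMr // trunc_log_le_ln.
have lnn : 0 <= ln n%:R :> R by rewrite ln_ge0.
have pow0 : 0 <= n%:R `^ (1 + k%:R^-1) :> R by rewrite powR_ge0.
have LK : (12 * (16 * L + 14))%:R <= K * (1 + ln n%:R).
  have -> : (12 * (16 * L + 14))%:R = 192 * t%:R + 360 :> R.
    by rewrite natrM natrD natrM /L -natr1; ring.
  have -> : K * (1 + ln n%:R) = 192 * (ln n%:R / ln 2) + 360 + (192 / ln 2 + 360 * ln n%:R).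
    by rewrite /K; ring.
  have := addr_ge0 c0 (mulr_ge0 (ler0n R 360) lnn).
  by lra.
suff : \sum_(lvl : {ffun 'I_n -> 'I_k}) lvl_prob R lvl * (added E w tb lvl)%:R
    <= (12 * (16 * L + 14))%:R * n%:R `^ (1 + k%:R^-1).
  by move=> /le_trans; apply; rewrite ler_wpM2r.
(* Large k gives the deterministic bound 4 (L + 1) n. Otherwise k <= 4 L + 2, so the factor 12 (4 k
   + 6) of the expected count is at most 12 (16 L + 14). *)
have [kL|kL] := leqP (4 * L + 3) k.
  apply: (@le_trans _ _ (\sum_(lvl : {ffun 'I_n -> 'I_k}) lvl_prob R lvl * (4 * L.+1 * n)%:R)).
    by apply: ler_sum => lvl _; rewrite ler_wpM2l ?lvl_prob_ge0 // ler_nat added_sparse.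
  rewrite -mulr_suml sum_lvl_prob // mul1r natrM ler_pM // ?ler_nat.
    by move: (L); clear; lia.
  by rewrite -{1}[n%:R]powRr1 // ler_powR // lerDl.
pose S (r : nat) (lvl : {ffun 'I_n -> 'I_k}) := #|[set c | (r <= lvl c)%N]|.
apply: (@le_trans _ _ (\sum_(lvl : {ffun 'I_n -> 'I_k})
    (6 * (4 * k + 6))%:R * (lvl_prob R lvl * (S (k.-1 - k./2)%N lvl * S k./2 lvl)%:R))).
  apply: ler_sum => lvl _; rewrite mulrCA -natrM ler_wpM2l ?lvl_prob_ge0 // ler_nat.
  exact: added_dense.
rewrite -mulr_sumr.
have kh : (k.-1 - k./2 + k./2)%N = k.-1 by rewrite subnK //; have [] := half_bounds k2.
have Ex := expected_level_pairs R n0 k2 kh.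
apply: le_trans (_ : (6 * (4 * k + 6))%:R * (2 * n%:R `^ (1 + k%:R^-1)) <= _).
  by rewrite ler_wpM2l.
rewrite mulrA ler_wpM2r // -natrM ler_nat.
by move: kL; move: (L); clear; lia.
Qed.
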